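(* Suppose there exist an integer $p\ge1$ and a set $C\in\mathcal B$ with $\mu(C)<\infty$ such that: (1.1) $f_*=\inf_{x,y\in C}f_p(y|x)>0$, where $f_p(y|x)$ is the $p$-step post-change transition density, i.e. the conditional density (with respect to $\mu$) of $X_{k+p}$ at $y$ given $X_k=x$ for the homogeneous Markov process with one-step transition density $f_1$; (1.2) there exists a (Lyapunov) function $\mathbf V:\mathcal X\to[1,\infty)$ such that $\mathbf V(x)\ge\widetilde g(x)$ for all $x\in\mathcal X$ and $\mathbf V^*=\sup_{x\in C}\mathbf V(x)<\infty$; (1.3) for some $0<\rho<1$ and $D>0$ and for all $x\in\mathcal X$, $\mathsf E_{x,0}\mathbf V(X_p)\le(1-\rho)\mathbf V(x)+D\,\mathbf 1_C(x)$. Suppose also that there exists $\mathbf r>2$ such that $$\sup_{k\ge1}\mathsf E_\infty\,g^*_{\mathbf r}(X_k)<\infty\quad\text{and}\quad\sup_{k\ge1}\mathsf E_\infty\,\upsilon^*_{\mathbf r}(X_k)<\infty,$$ where $g^*_{\mathbf r}(x)=\sup_{n\ge1}\mathsf E_{x,0}|g(X_n,X_{n-1})|^{\mathbf r}$ and $\upsilon^*_{\mathbf r}(x)=\sup_{n\ge0}\mathsf E_{x,0}[\mathbf V(X_n)]^{\mathbf r}$. Then, with $I=\lambda(\widetilde g)=\int_{\mathcal X}\widetilde g(x)\,\lambda(dx)$, $$\sum_{n=1}^\infty\sup_{k\ge0}\mathsf P_k\Big\{\Big|\frac1nZ^k_{k+n}-I\Big|>\varepsilon\Big\}<\infty\quad\text{for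 all }\varepsilon>0.$$
   Context: $(\mathcal X,\mathcal B)$ is a measurable space with a sigma-finite positive measure $\mu$. For a change point $\nu\in\{0,1,2,\dots\}\cup\{\infty\}$, the observed sequence $(X_n)$ with initial value $X_0$ (whose law does not depend on $\nu$) is, under $\mathsf P_\nu$ (expectation $\mathsf E_\nu$), a Markov process on $\mathcal X$ such that the transition from $X_{n-1}=x$ to $X_n=y$ has density $f_0(y|x)$ with respect to $\mu$ for $n\le\nu$ and density $f_1(y|x)$ with respect to $\mu$ for $n>\nu$ ($\nu=\infty$: always $f_0$). The homogeneous Markov process with transition density $f_1$ is positive ergodic with stationary (invariant) probability distribution $\lambda$. $\mathsf P_{x,0}(\cdot)=\mathsf P_0(\cdot\mid X_0=x)$, with expectation $\mathsf E_{x,0}$, is the law of the chain with transition density $f_1$ started at $X_0=x$. Put $$g(y,x)=\log\frac{f_1(y|x)}{f_0(y|x)},\qquad Z^k_n=\sum_{j=k+1}^ng(X_j,X_{j-1})\ (0\le k<n),\qquad \widetilde g(x)=\int_{\mathcal X}g(y,x)f_1(y|x)\,\mu(dy),$$ where $g:\mathcal X\times\mathcal X\to\mathbb R$ is measurable and the integrals defining $\widetilde g$ and $\lambda(\widetilde g)$ are assumed to exist.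
   Formalization: As stated the claim fails at k=0, since the moment conditions (k≥1) do not constrain X_0 (e.g. Cauchy X_0, Gaussian AR(1)). Proved: the sum with sup over k≥1 under the stated conditions, and with sup over k≥0 if also E_∞ g*_r(X_0) and E_∞ υ*_r(X_0) are finite. *)

(* Defs.v *)
From HB Require Import structures.
From mathcomp Require Import all_boot all_order all_algebra.
From mathcomp Require Import all_classical all_reals all_analysis.
From mathcomp Require Import measurable_realfun.

Set Implicit Arguments.
Unset Strict Implicit.
Unset Printing Implicit Defensive.

Import Order.TTheory GRing.Theory Num.Theory.
Import numFieldNormedType.Exports.

Local Open Scope classical_set_scope.
Local Open Scope ring_scope.
Local Open Scope ereal_scope.

(* Transition densities take the departure point first: [f x y] is f(y|x).
   The change point nu is an [option nat], [None] being nu = oo. *)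

Section Defs.
Context {d dO : measure_display} {T : measurableType d}
  {Omega : measurableType dO} {R : realType}.
Implicit Types (mu : {sigma_finite_measure set T -> \bar R})
  (f : T -> T -> R) (X : nat -> Omega -> T).

Definition transition_density mu f : Prop :=
  [/\ measurable_fun [set: T * T] (fun z : T * T => f z.1 z.2),
      (forall x y, (0 <= f x y)%R) &
      (forall x, \int[mu]_y (f x y)%:E = 1)].

(* The Lebesgue integral exists, possibly with an infinite value: the positive
   part or the negative part has a finite integral. *)
Definition integral_exists {dS} {S : measurableType dS}
    (m : {measure set S -> \bar R}) (h : S -> \bar R) : Prop :=
  measurable_fun [set: S] h /\
  (\int[m]_x (h^\+ x) < +oo \/ \int[m]_x (h^\- x) < +oo).

Definition history X (n : nat) : set (set Omega) :=
  <<s [set A | exists i B, [/\ (i <= n)%N, measurable B & A = X i @^-1` B]] >>.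

(* Markov property with respect to the natural filtration, [f n] being the
   density of the transition from X_{n-1} to X_n; the last clause says that
   P(X_{n+1} \in B | X_0, ..., X_n) = \int_B f_{n+1}(y | X_n) mu(dy) a.s. *)
Definition markov_process mu (P : probability Omega R) X
    (f : nat -> T -> T -> R) : Prop :=
  (forall n, measurable_fun [set: Omega] (X n)) /\
  (forall n A B, history X n A -> measurable B ->
    P (A `&` X n.+1 @^-1` B) =
    \int[P]_(w in A) \int[mu]_(y in B) (f n.+1 (X n w) y)%:E).

Definition change_density (f0 f1 : T -> T -> R) (nu : option nat) (n : nat) :
    T -> T -> R :=
  if nu is Some k then (if (n <= k)%N then f0 else f1) else f0.

Definition change_point_model mu (f0 f1 : T -> T -> R) X
    (P : option nat -> probability Omega R) : Prop :=
  (forall nu, markov_process mu (P nu) X (change_density f0 f1 nu)) /\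
  (forall nu B, measurable B -> P nu (X 0%N @^-1` B) = P None (X 0%N @^-1` B)).

(* [Px x] is the law of the homogeneous chain with transition density [f]
   started at x. *)
Definition started_chain mu f X (Px : T -> probability Omega R) : Prop :=
  forall x, markov_process mu (Px x) X (fun=> f) /\
    (forall B, measurable B -> Px x (X 0%N @^-1` B) = \d_x B).

(* Positive ergodicity: [lambda] is an invariant probability and the n-step
   laws converge to it in total variation from every starting point. *)
Definition positive_ergodic mu f X (Px : T -> probability Omega R)
    (lambda : probability T R) : Prop :=
  (forall B, measurable B ->
    lambda B = \int[lambda]_x \int[mu]_(y in B) (f x y)%:E) /\
  (forall x, ereal_sup [set `|Px x (X n @^-1` B) - lambda B| |
      B in (measurable : set (set T))] @[n --> \oo] --> (0 : \bar R)).

(* By homogeneity of the chain under [Px], the conditional law of X_{k+p} given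
   X_k = x is the law of X_p under [Px x]. *)
Definition step_density mu X (Px : T -> probability Omega R) (p : nat)
    (fp : T -> T -> \bar R) : Prop :=
  forall x, [/\ measurable_fun [set: T] (fp x), (forall y, 0 <= fp x y) &
    (forall B, measurable B -> Px x (X p @^-1` B) = \int[mu]_(y in B) fp x y)].

Definition llr (f0 f1 : T -> T -> R) (y x : T) : R :=
  ln (f1 x y / f0 x y)%R.

Definition LLR (f0 f1 : T -> T -> R) X (k n : nat) (w : Omega) : R :=
  (\sum_(k.+1 <= j < n.+1) llr f0 f1 (X j w) (X j.-1 w))%R.

Definition mean_llr mu (f0 f1 : T -> T -> R) (x : T) : \bar R :=
  \int[mu]_y (llr f0 f1 y x * f1 x y)%:E.

Definition gstar (f0 f1 : T -> T -> R) X (Px : T -> probability Omega R)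
    (r : R) (x : T) : \bar R :=
  ereal_sup [set \int[Px x]_w (`|llr f0 f1 (X n w) (X n.-1 w)| `^ r)%:E |
    n in [set n | (1 <= n)%N]].

Definition vstar (V : T -> R) X (Px : T -> probability Omega R)
    (r : R) (x : T) : \bar R :=
  ereal_sup [set \int[Px x]_w (V (X n w) `^ r)%:E | n in [set: nat]].

Definition deviation (f0 f1 : T -> T -> R) X (I : \bar R) (eps : R)
    (k n : nat) : set Omega :=
  [set w | eps%:E < `|(n%:R^-1 * LLR f0 f1 X k (k + n)%N w)%:E - I |].

End Defs.

(* Main.v *)
Require Import Defs.
From HB Require Import structures.
From mathcomp Require Import all_boot all_order all_algebra.
From mathcomp Require Import all_classical all_reals all_analysis.
From mathcomp Require Import measurable_realfun.
From mathcomp Require Import ring lra.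

Set Implicit Arguments.
Unset Strict Implicit.
Unset Printing Implicit Defensive.

Import Order.TTheory GRing.Theory Num.Theory.
Import numFieldNormedType.Exports.

Local Open Scope classical_set_scope.
Local Open Scope ring_scope.
Local Open Scope ereal_scope.

(** Fix the change point k and write Y_j for X_(k+j): under P_k this is a Markov
    chain whose transition operator K averages against f1(.|x).  The idea is to
    correct the log-likelihood ratio into a martingale.

    Let h be the conditional mean of g.  It is a relative entropy, so that
    0 <= h <= V.  On C the p-step kernel Q = K^p dominates the measure
    nu = c mu|_C, and Q' = Q - 1_C nu, the chain killed when it regenerates, is
    still a nonnegative kernel.  If delta is the mass of nu, the drift condition
    gives Q'(V + D/delta) <= V + D/delta - rho V: the term D lost on C is repaid
    by the mass removed there.  Hence the potentials A and B of h and 1 for Q'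
    are at most a multiple of V ([regeneration_potential]), and
    A + 1_C nu(A) = h + Q A, and likewise B + 1_C nu(B) = 1 + Q B.  The
    invariant law lambda integrates V ([stationary_Lyapunov]); integrating both
    identities against it gives lambda(C) nu(A) = I and lambda(C) nu(B) = 1.
    So the regeneration terms cancel in u = A - I B, and u - Q u = h - I
    ([poisson_solution]).  The sum v of K^i u over i < p then satisfies
    v - K v = h - I wherever the evolution of V is finite, which is almost
    everywhere along the chain.

    Consequently g(Y_(j+1), Y_j) - I + v(Y_(j+1)) - v(Y_j) has conditional mean
    zero ([increment_mean]), and by Jensen's inequality its r-th moments are
    bounded by those of g and V.  For r > 2 a second-order expansion of |x|^r
    yields E|M_n|^r <= const n^(r/2) for the sum M_n of these increments
    ([martingale_moment]).  The centred log-likelihood ratio differs from M_n by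
    v(Y_0) - v(Y_n), so Markov's inequality at level n eps bounds the deviation
    probability by const n^(-r/2) ([deviation_tail]), which is summable.  The
    change point enters the constant only through the moments of g and V seen
    from X_k, whose law is the same as without change: the bound is uniform. *)

(** * Powers and the growth of a recursion *)

Section power_inequalities.
Local Open Scope ring_scope.
Context {R : realType}.
Implicit Types a b r s u v x y : R.

Lemma expR_le_quadratic v B : `|v| <= B -> expR v <= 1 + v + expR B * v ^+ 2.
Proof.
move=> vB; have vleB : v <= B by apply: le_trans vB; exact: ler_norm.
have eB1 : 1 <= expR B by rewrite -expR0 ler_expR (le_trans _ vB).
have evB : expR v <= expR B by rewrite ler_expR.
have ev : expR v - 1 <= v * expR v.
  have := expR_ge1Dx (- v); rewrite expRN.
  have := expR_gt0 v => ev0; rewrite -(ler_pM2r ev0) mulVf ?gt_eqF//; lra.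
have v2 : 0 <= v ^+ 2 by exact: sqr_ge0.
suff : v * (expR v - 1) <= expR B * v ^+ 2 by lra.
have [v0|v0] := leP 0 v.
  apply: (@le_trans _ _ (v * (v * expR v))); first exact: ler_wpM2l.
  rewrite mulrA -expr2 mulrC ler_wpM2r//.
have h : v <= expR v - 1 by have := expR_ge1Dx v; lra.
apply: (@le_trans _ _ (v ^+ 2)); last by rewrite ler_peMl.
by rewrite expr2 ler_wnM2l// ltW.
Qed.

Lemma powR_split r x : 2 < r -> 0 <= x -> x `^ r = x `^ (r - 2) * x ^+ 2.
Proof.
move=> r2 x0; rewrite -powR_mulrn// -powRD ?subrK//.
by apply/implyP => /eqP; lra.
Qed.

Lemma ler_powRl r x y : 0 <= r -> 0 <= x -> x <= y -> x `^ r <= y `^ r.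
Proof.
by move=> r0 x0 xy; apply: ge0_ler_powR; rewrite ?nnegrE// (le_trans x0).
Qed.

Lemma powR_normD r a b : 0 <= r ->
  `|a + b| `^ r <= 2 `^ r * (`|a| `^ r + `|b| `^ r).
Proof.
move=> r0; wlog ab : a b / `|a| <= `|b|.
  move=> H; have [/H//|/ltW/H] := leP `|a| `|b|.
  by rewrite (addrC b) (addrC (`|b| `^ r)).
apply: (@le_trans _ _ ((2 * `|b|) `^ r)).
  by apply: ler_powRl => //; rewrite (le_trans (ler_normD _ _))//; lra.
by rewrite powRM// ler_wpM2l ?powR_ge0// lerDr powR_ge0.
Qed.

Lemma powR1D_le r u : 0 < r -> `|u| <= 2^-1 ->
  (1 + u) `^ r <= 1 + r * u + expR (r / 2) * r ^+ 2 * u ^+ 2.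
Proof.
move=> r0; rewrite ler_norml => /andP[u1 u2].
have u0 : 0 < 1 + u by lra.
rewrite /powR gt_eqF//.
apply: (@le_trans _ _ (expR (r * u))).
  by rewrite ler_expR ler_pM2l// le_ln1Dx//; lra.
rewrite -mulrA -exprMn; apply: expR_le_quadratic.
by rewrite normrM gtr0_norm// ler_pM2l// ler_norml; lra.
Qed.

Definition smooth_cst r : R := expR (r / 2) * r ^+ 2 + 3 `^ r + r * 2 `^ r.

(** A second-order Taylor bound of the power function with exponent r > 2:
    below half of |a| the increment b is small enough for the exponential
    bound, and above it every term is controlled by the power of b alone. *)
Lemma powRD_taylor r a b : 2 < r ->
  `|a + b| `^ r <= `|a| `^ r + r * `|a| `^ (r - 2) * a * b
    + smooth_cst r * (`|a| `^ (r - 2) * b ^+ 2 + `|b| `^ r).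
Proof.
move=> r2; have r0 : 0 < r by lra.
have c1 : 0 <= expR (r / 2) * r ^+ 2 by rewrite mulr_ge0 ?expR_ge0 ?sqr_ge0.
have c2 : 0 <= 3 `^ r by exact: powR_ge0.
have c3 : 0 <= r * 2 `^ r by rewrite mulr_ge0 ?powR_ge0 ?ltW.
have p1 : 0 <= `|a| `^ (r - 2) * b ^+ 2 by rewrite mulr_ge0 ?powR_ge0 ?sqr_ge0.
have p2 : 0 <= `|b| `^ r by rewrite powR_ge0.
have [ba|ab] := leP `|b| (`|a| / 2).
  have [a0|a0] := eqVneq a 0.
    have b0 : b = 0.
      by apply/eqP; rewrite -normr_le0 (le_trans ba)// a0 normr0 mul0r.
    rewrite a0 b0 addr0 normr0 powR0 ?gt_eqF// mulr0 expr0n/= !mulr0.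
    by rewrite !addr0 mulr0.
  pose u := b / a.
  have bE : b = a * u by rewrite /u mulrCA divff ?mulr1.
  have u12 : `|u| <= 2^-1.
    by rewrite normrM normfV ler_pdivrMr ?normr_gt0// mulrC.
  have -> : a + b = a * (1 + u) by rewrite bE; ring.
  have u0 : 0 <= 1 + u by move: u12; rewrite ler_norml => /andP[]; lra.
  rewrite normrM (ger0_norm u0) powRM//.
  apply: (@le_trans _ _ (`|a| `^ r * (1 + r * u + expR (r / 2) * r ^+ 2 * u ^+ 2))).
    by rewrite ler_wpM2l ?powR_ge0// powR1D_le.
  have -> : r * `|a| `^ (r - 2) * a * b = `|a| `^ r * (r * u).
    by rewrite (powR_split r2)// real_normK ?num_real// bE; ring.
  have E : `|a| `^ (r - 2) * b ^+ 2 = `|a| `^ r * u ^+ 2.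
    by rewrite (powR_split r2)// real_normK ?num_real// bE; ring.
  apply: (@le_trans _ _ (`|a| `^ r + `|a| `^ r * (r * u) +
      expR (r / 2) * r ^+ 2 * (`|a| `^ (r - 2) * b ^+ 2))).
    by rewrite E; lra.
  rewrite lerD2l; apply: ler_pM => //; rewrite /smooth_cst; lra.
have {}ab : `|a| <= 2 * `|b| by lra.
have h1 : `|a + b| `^ r <= 3 `^ r * `|b| `^ r.
  rewrite -powRM//; apply: ler_powRl => //; first lra.
  by rewrite (le_trans (ler_normD _ _))//; lra.
have h2 : - (r * `|a| `^ (r - 2) * a * b) <= r * 2 `^ r * `|b| `^ r.
  apply: (@le_trans _ _ (r * ((2 * `|b|) `^ (r - 2) * (2 * `|b|) * `|b|))).
    apply: (@le_trans _ _ (r * (`|a| `^ (r - 2) * (`|a| * `|b|)))).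
      rewrite -!mulrA -mulrN ler_pM2l// -mulrN ler_wpM2l ?powR_ge0//.
      by rewrite -normrM -normrN ler_norm.
    rewrite ler_pM2l// -mulrA; apply: ler_pM; [exact: powR_ge0|exact: mulr_ge0| |].
      by apply: ler_powRl => //; lra.
    by rewrite ler_wpM2r.
  rewrite -[leRHS]mulrA ler_pM2l// -powRM// (powR_split r2)//.
  rewrite -mulrA ler_wpM2l ?powR_ge0// expr2.
  by have := normr_ge0 b; nra.
have : 0 <= `|a| `^ r by exact: powR_ge0.
rewrite /smooth_cst; nra.
Qed.


(** Comparing s y^2 with x^2, the product is dominated by the power of one of
    its two factors. *)
Lemma powR_young2 r s x y : 2 < r -> 0 < s -> 0 <= x -> 0 <= y ->
  x `^ (r - 2) * y ^+ 2 <= x `^ r / s + s `^ (r / 2 - 1) * y `^ r.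
Proof.
move=> r2 s0 x0 y0.
have p1 : 0 <= x `^ r / s by rewrite divr_ge0 ?powR_ge0// ltW.
have p2 : 0 <= s `^ (r / 2 - 1) * y `^ r by rewrite mulr_ge0 ?powR_ge0.
have [sy|xs] := leP (s * y ^+ 2) (x ^+ 2).
  apply: (@le_trans _ _ (x `^ r / s)); last by rewrite lerDl.
  rewrite (powR_split r2)// -mulrA ler_wpM2l ?powR_ge0//.
  by rewrite ler_pdivlMr// mulrC.
apply: (@le_trans _ _ (s `^ (r / 2 - 1) * y `^ r)); last by rewrite lerDr.
rewrite (powR_split r2 y0) mulrA ler_wpM2r ?sqr_ge0//.
(* here x < sqrt s * y *)
have -> : r / 2 - 1 = 2^-1 * (r - 2) by field.
rewrite powRrM -powRM ?powR_ge0//; apply: ler_powRl => //; first lra.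
rewrite (powR12_sqrt (ltW s0)) -(@ler_pXn2r _ 2)// ?nnegrE ?mulr_ge0 ?sqrtr_ge0//.
by rewrite exprMn (sqr_sqrtr (ltW s0)) ltW.
Qed.

Lemma smooth_cst_ge0 r : 0 <= r -> 0 <= smooth_cst r.
Proof.
by move=> r0;
  rewrite /smooth_cst !addr_ge0 ?mulr_ge0 ?expR_ge0 ?sqr_ge0 ?powR_ge0.
Qed.

(** The form used along a sum of s terms: the relative growth c / s of the
    leading power is then harmless, and b is charged s ^ (r / 2 - 1) only. *)
Lemma powRD_increment r s a b : 2 < r -> 1 <= s ->
  `|a + b| `^ r <= (1 + smooth_cst r / s) * `|a| `^ r
    + r * `|a| `^ (r - 2) * a * b
    + 2 * smooth_cst r * s `^ (r / 2 - 1) * `|b| `^ r.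
Proof.
move=> r2 s1; have c0 : 0 <= smooth_cst r by apply: smooth_cst_ge0; lra.
have h1 := powRD_taylor a b r2.
have h2 := powR_young2 r2 (lt_le_trans ltr01 s1) (normr_ge0 a) (normr_ge0 b).
rewrite real_normK ?num_real// in h2.
(* r / 2 - 1 > 0 and s >= 1: the power of b alone is absorbed *)
have h3 : `|b| `^ r <= s `^ (r / 2 - 1) * `|b| `^ r.
  rewrite ler_peMl ?powR_ge0// -[leLHS](powRr0 s) ler_powR//; lra.
apply: (le_trans h1).
have : smooth_cst r * (`|a| `^ (r - 2) * b ^+ 2 + `|b| `^ r) <=
  smooth_cst r * (`|a| `^ r / s + 2 * (s `^ (r / 2 - 1) * `|b| `^ r)).
  by rewrite ler_wpM2l//; lra.
lra.
Qed.

(** Young's inequality for the conjugate exponents r and r / (r - 1): the graph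
    of the power function lies above its tangent at a. *)
Lemma powR_tangent r a t : 1 < r -> 0 <= a -> 0 <= t ->
  r * a `^ (r - 1) * t <= t `^ r + (r - 1) * a `^ r.
Proof.
move=> r1 a0 t0; have r0 : 0 < r by lra.
have q0 : 0 < r / (r - 1) by rewrite divr_gt0//; lra.
have := @conjugate_powR R t (a `^ (r - 1)) r (r / (r - 1)) t0 (powR_ge0 _ _) r0 q0.
rewrite -powRrM invf_div.
have -> : (r - 1) * (r / (r - 1)) = r by field; lra.
have -> : r^-1 + (r - 1) / r = 1 by field; lra.
move=> /(_ erefl); rewrite -(ler_pM2l r0) => h.
have -> : r * a `^ (r - 1) * t = r * (t * a `^ (r - 1)) by ring.
apply: (le_trans h); rewrite le_eqVlt; apply/orP; left; apply/eqP; field; lra.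
Qed.

Lemma discrete_gronwall (c e : R) (n : nat) (u : nat -> R) :
  0 <= c -> 0 <= e -> u 0%N = 0 ->
  (forall j, (j < n)%N -> u j.+1 <= (1 + c / n%:R) * u j + e) ->
  u n <= n%:R * (expR c * e).
Proof.
move=> c0 e0 u0 uS; pose q := 1 + c / n%:R.
have q1 : 1 <= q by rewrite lerDl divr_ge0.
suff H j : (j <= n)%N -> u j <= j%:R * (q ^+ j * e).
  apply: (le_trans (H n (leqnn n))); rewrite ler_wpM2l// ler_wpM2r//.
  have [->|n0] := posnP n; first by rewrite expr0 -expR0 ler_expR.
  apply: (@le_trans _ _ (expR (c / n%:R) ^+ n)).
    by rewrite lerXn2r ?nnegrE ?expR_ge0 ?expR_ge1Dx// (le_trans _ q1).
  by rewrite -expRM_natr divfK ?pnatr_eq0 ?gtn_eqF.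
elim: j => [_|j IH jn]; first by rewrite u0 mul0r.
apply: (le_trans (uS j jn)).
apply: (@le_trans _ _ (q * (j%:R * (q ^+ j * e)) + e)).
  by rewrite lerD2r ler_wpM2l ?(le_trans _ q1)//; exact/IH/ltnW.
have : e <= q ^+ j.+1 * e by rewrite ler_peMl// exprn_ege1.
by rewrite exprS -natr1; lra.
Qed.

(** Bernoulli's inequality for (1 - 1 / (m + 1)) ^ (1 - s); it makes the sums of
    n ^ (- s) telescope. *)
Lemma telescope_powR (s : R) (m : nat) : 1 < s -> (0 < m)%N ->
  (s - 1) * m.+1%:R `^ (- s) <= m%:R `^ (1 - s) - m.+1%:R `^ (1 - s).
Proof.
move=> s1 m0.
have m0' : 0 < m%:R :> R by rewrite ltr0n.
have M0 : 0 < m.+1%:R :> R by rewrite ltr0n.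
have Mp : 0 < m.+1%:R `^ (1 - s) :> R by rewrite powR_gt0.
have -> : m.+1%:R `^ (- s) = m.+1%:R `^ (1 - s) / m.+1%:R :> R.
  rewrite [in LHS](_ : - s = (1 - s) + (-1)); last by ring.
  rewrite powRD; first by rewrite powR_inv1.
  by apply/implyP.
have -> : m%:R = m.+1%:R * (1 - m.+1%:R^-1) :> R.
  by rewrite mulrBr mulr1 divff ?gt_eqF// -natr1 addrK.
have q0 : 0 < 1 - m.+1%:R^-1 :> R.
  by rewrite subr_gt0 invf_lt1// ltr1n.
rewrite (powRM _ (ltW M0) (ltW q0)).
suff : 1 + (s - 1) / m.+1%:R <= (1 - m.+1%:R^-1) `^ (1 - s) :> R.
  have K (x y z w : R) : x * (1 + w * y) <= x * z -> w * (x * y) <= x * z - x.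
    by lra.
  by rewrite -(ler_pM2l Mp); exact: K.
rewrite /powR gt_eqF//; apply: le_trans (expR_ge1Dx _) _.
rewrite ler_expR -[leRHS]mulrNN opprB ler_pM2l ?subr_gt0// lerNr le_ln1Dx//.
by rewrite ltrN2 invf_lt1// ltr1n.
Qed.

End power_inequalities.

Lemma nneseries_powR_lty (R : realType) (c s : R) : (0 <= c)%R -> (1 < s)%R ->
  \sum_(1 <= n <oo) (c * n%:R `^ (- s))%:E < +oo.
Proof.
move=> c0 s1; have s10 : (0 < s - 1)%R by rewrite subr_gt0.
suff : \sum_(1 <= n <oo) (c * n%:R `^ (- s))%:E <= (c * (1 + (s - 1)^-1))%:E.
  by move=> /le_lt_trans; apply; exact: ltry.
apply: lime_le.
  by apply: is_cvg_nneseries => n _ _; rewrite lee_fin mulr_ge0 ?powR_ge0.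
apply: nearW => N; rewrite sumEFin lee_fin -mulr_sumr ler_wpM2l//.
elim: N => [|N IH]; first by rewrite big_geq ?addr_ge0 ?invr_ge0 ?ltW.
suff H M : (\sum_(1 <= n < M.+2) n%:R `^ (- s) <=
    1 + (s - 1)^-1 * (1 - M.+1%:R `^ (1 - s)) :> R)%R.
  case: N {IH} => [|N]; first by rewrite big_geq ?addr_ge0 ?invr_ge0 ?ltW.
  apply: (le_trans (H N)); rewrite lerD2l; apply: ler_piMr.
    by rewrite invr_ge0 ltW.
  by rewrite gerBl powR_ge0.
elim: M => [|M IHM]; first by rewrite big_nat1 !powR1 subrr mulr0 addr0.
rewrite big_nat_recr//=.
have si : (0 < (s - 1)^-1)%R by rewrite invr_gt0.
have := telescope_powR s1 (ltn0Sn M); rewrite -(ler_pM2l si).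
by rewrite mulKf ?gt_eqF//; lra.
Qed.

(** * Measures with a density and laws on products *)

Section density.
Context d (S : measurableType d) (R : realType).
Variables (m : {measure set S -> \bar R}) (h : S -> R).
Hypotheses (mh : measurable_fun setT h) (h0 : forall x, (0 <= h x)%R).

(** The proofs that h is measurable and nonnegative are arguments, so that the
    measure structure of the density is inferred from the term. *)
Definition density (mh : measurable_fun setT h) (h0 : forall x, (0 <= h x)%R)
  (E : set S) : \bar R := \int[m]_(x in E) (h x)%:E.

Local Notation nu := (density mh h0).

Let density0 : nu set0 = 0. Proof. by rewrite /density integral_set0. Qed.

Let density_ge0 E : 0 <= nu E.
Proof. by apply: integral_ge0 => x _; rewrite lee_fin. Qed.

Let density_sigma_additive : semi_sigma_additive nu.
Proof.
move=> F mF tF mUF; rewrite /density ge0_integral_bigcup//; last 2 first.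
- by apply/measurable_EFinP; exact: measurable_funTS.
- by move=> x _; rewrite lee_fin.
apply: is_cvg_ereal_nneg_natsum_cond => n _ _.
by apply: integral_ge0 => x _; rewrite lee_fin.
Qed.

HB.instance Definition _ := isMeasure.Build _ _ _ nu
  density0 density_ge0 density_sigma_additive.

Import HBNNSimple.

Lemma integral_density (phi : S -> \bar R) :
  measurable_fun setT phi -> (forall x, 0 <= phi x) ->
  \int[nu]_x phi x = \int[m]_x (phi x * (h x)%:E).
Proof.
move=> mphi phi0.
have mhE : measurable_fun setT (EFin \o h) by exact/measurable_EFinP.
have hE E : measurable E -> nu E = \int[m]_x ((\1_E x)%:E * (h x)%:E).
  by move=> mE; rewrite /= /density integral_mkcond; apply: eq_integral => x _;
    rewrite epatch_indic muleC.
have hg (g : {nnsfun S >-> R}) :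
    \int[nu]_x (g x)%:E = \int[m]_x ((g x)%:E * (h x)%:E).
  rewrite integralT_nnsfun sintegralE.
  transitivity (\sum_(r \in range g)
      r%:E * \int[m]_x ((\1_(g @^-1` [set r]) x)%:E * (h x)%:E)).
    by apply: eq_fsbigr => r _; congr (_ * _); exact: hE.
  transitivity (\sum_(r \in range g)
      \int[m]_x (r%:E * ((\1_(g @^-1` [set r]) x)%:E * (h x)%:E))).
    apply: eq_fsbigr => r; rewrite inE => -[z _ <-].
    rewrite ge0_integralZl//; last by rewrite lee_fin.
      by apply: emeasurable_funM => //; exact/measurable_EFinP.
    by move=> x _; rewrite mule_ge0 ?lee_fin.
  rewrite -ge0_integral_fsum//; last 2 first.
    by move=> r; apply: measurable_funeM; apply: emeasurable_funM => //;
       exact/measurable_EFinP.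
    by move=> r x _; rewrite muleA mule_ge0 ?nnfun_muleindic_ge0 ?lee_fin.
  apply: eq_integral => x _.
  under eq_fsbigr do rewrite muleA.
  rewrite -ge0_mule_fsuml; last by move=> r; exact: nnfun_muleindic_ge0.
  by congr (_ * _); rewrite [in RHS](fimfunE g) fsumEFin.
pose g := nnsfun_approx measurableT mphi.
have gphi x : (g n x)%:E @[n --> \oo] --> phi x.
  by apply: cvg_nnsfun_approx.
have ndg x : nondecreasing_seq (fun n => (g n x)%:E).
  by move=> a b ab; rewrite lee_fin; exact/lefP/nd_nnsfun_approx.
transitivity (\int[nu]_x limn (fun n => (g n x)%:E)).
  by apply: eq_integral => x _; apply/esym/cvg_lim => //; exact: gphi.
rewrite monotone_convergence//; last 2 first.
- by move=> n; exact/measurable_EFinP.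
- by move=> n x _; rewrite lee_fin.
transitivity (\int[m]_x limn (fun n => (g n x)%:E * (h x)%:E)); last first.
  apply: eq_integral => x _; apply/cvg_lim => //.
  by apply: cvgeZr => //; exact: gphi.
rewrite (@monotone_convergence _ _ _ m _ measurableT
  (fun n x => (g n x)%:E * (h x)%:E))//.
- by under eq_fun do rewrite hg.
- by move=> n; apply: emeasurable_funM => //; exact/measurable_EFinP.
- by move=> n x _; rewrite mule_ge0 ?lee_fin.
- by move=> x _ a b ab; rewrite lee_wpmul2r ?lee_fin//; exact: ndg.
Qed.

End density.

Lemma prod_measure_unique d1 d2 (U : measurableType d1)
    (W : measurableType d2) (R : realType)
    (m1 m2 : {measure set (U * W) -> \bar R}) : m1 setT < +oo ->
  (forall A B, measurable A -> measurable B -> m1 (A `*` B) = m2 (A `*` B)) ->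
  forall E, measurable E -> m1 E = m2 E.
Proof.
move=> m1fin E12.
pose C : set (set (U * W)) := [set A `*` B | A in measurable & B in measurable].
have CI : setI_closed C.
  move=> _ _ [A1 mA1 [B1 mB1 <-]] [A2 mA2 [B2 mB2 <-]]; rewrite -setXI.
  exists (A1 `&` A2); first exact: measurableI.
  by exists (B1 `&` B2) => //; exact: measurableI.
move=> E mE; apply: (measure_unique C (fun=> setT)) => //.
- by rewrite measurable_prod_measurableType.
- by move=> _; exists setT => //; exists setT => //; rewrite setXTT.
- by rewrite bigcup_const.
- by move=> _ [A mA [B mB <-]]; exact: E12.
Qed.

Section transfer.
Context d1 d2 (S1 : measurableType d1) (S2 : measurableType d2) (R : realType).
Variables (m1 : {measure set S1 -> \bar R}) (m2 : {measure set S2 -> \bar R}).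

Lemma ge0_integral_transfer d (U : measurableType d) (p1 : S1 -> U)
    (p2 : S2 -> U) (phi : U -> \bar R) :
  measurable_fun setT p1 -> measurable_fun setT p2 ->
  (forall E, measurable E -> m1 (p1 @^-1` E) = m2 (p2 @^-1` E)) ->
  measurable_fun setT phi -> (forall u, 0 <= phi u) ->
  \int[m1]_x phi (p1 x) = \int[m2]_x phi (p2 x).
Proof.
move=> mp1 mp2 E12 mphi phi0.
have /= <- := ge0_integral_pushforward mp1 m1 measurableT mphi (in1W phi0).
have /= <- := ge0_integral_pushforward mp2 m2 measurableT mphi (in1W phi0).
by apply: eq_measure_integral => A mA _; exact: E12.
Qed.

Lemma ge0_integral_transfer2 d3 d4 (U : measurableType d3)
    (W : measurableType d4) (p1 : S1 -> U * W) (p2 : S2 -> U * W)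
    (phi : U * W -> \bar R) :
  measurable_fun setT p1 -> measurable_fun setT p2 -> m1 setT < +oo ->
  (forall A B, measurable A -> measurable B ->
    m1 (p1 @^-1` (A `*` B)) = m2 (p2 @^-1` (A `*` B))) ->
  measurable_fun setT phi -> (forall u, 0 <= phi u) ->
  \int[m1]_x phi (p1 x) = \int[m2]_x phi (p2 x).
Proof.
move=> mp1 mp2 m1fin E12; apply: ge0_integral_transfer => // E mE.
rewrite -[LHS]/(pushforward m1 p1 E) -[RHS]/(pushforward m2 p2 E).
exact: prod_measure_unique.
Qed.

End transfer.

(** Only the simple functions below an integrand enter its integral, so the
    larger function may be a supremum of unknown measurability. *)
Lemma ge0_le_integral_nonmeas d (S : measurableType d) (R : realType)
    (m : {measure set S -> \bar R}) (f1 f2 : S -> \bar R) :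
  (forall x, 0 <= f1 x) -> (forall x, f1 x <= f2 x) ->
  \int[m]_x f1 x <= \int[m]_x f2 x.
Proof.
move=> f10 f12; have f20 x : 0 <= f2 x by exact: le_trans (f12 x).
rewrite !ge0_integralTE//; apply: le_ereal_sup => _ [g gf1 <-].
by exists g => // x; exact: le_trans (f12 x).
Qed.

(** * The Markov property for functions *)

Section markov.
Context (R : realType) (d dO : measure_display)
  (T : measurableType d) (Omega : measurableType dO).
Variables (mu : {sigma_finite_measure set T -> \bar R}).

Definition trans_op (f : T -> T -> R) (h : T -> \bar R) (x : T) : \bar R :=
  \int[mu]_y (h y * (f x y)%:E).

Lemma measurable_kernel_integral dS (S : measurableType dS) (f : T -> T -> R)
    (phi : S * T -> \bar R) (X : S -> T) : transition_density mu f ->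
  measurable_fun setT X ->
  measurable_fun setT phi -> (forall z, 0 <= phi z) ->
  measurable_fun setT (fun s => \int[mu]_y (phi (s, y) * (f (X s) y)%:E)).
Proof.
move=> [mf f0 _] mX mphi phi0.
apply: (@measurable_fun_fubini_tonelli_F _ _ S T R mu
  (fun z => phi z * (f (X z.1) z.2)%:E)).
  apply: emeasurable_funM => //; apply/measurable_EFinP.
  apply: (measurableT_comp mf (g := fun z => (X z.1, z.2))).
  by apply/measurable_fun_pair => //=; apply: measurableT_comp.
by move=> z; rewrite mule_ge0// lee_fin.
Qed.

Lemma measurable_trans_op f h : transition_density mu f ->
  measurable_fun setT h -> (forall x, 0 <= h x) ->
  measurable_fun setT (trans_op f h).
Proof.
move=> hf mh h0.
have := @measurable_kernel_integral _ T f (fun z => h z.2) idfun hf.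
by move=> H; apply: (H (@measurable_id _ _ _)) => //; exact: measurableT_comp.
Qed.

Lemma trans_op_ge0 f h x : transition_density mu f -> (forall x, 0 <= h x) ->
  0 <= trans_op f h x.
Proof.
move=> [_ f0 _] h0; apply: integral_ge0 => y _.
by rewrite mule_ge0// lee_fin.
Qed.

Lemma iter_trans_op_ge0 f1 n h x : transition_density mu f1 ->
  (forall x, 0 <= h x) -> 0 <= iter n (trans_op f1) h x.
Proof. by move=> hf1 h0; elim: n x => //= n IH x; exact: trans_op_ge0. Qed.

Lemma measurable_iter_trans_op f1 n h : transition_density mu f1 ->
  measurable_fun setT h -> (forall x, 0 <= h x) ->
  measurable_fun setT (iter n (trans_op f1) h).
Proof.
move=> hf1 mh h0; elim: n => //= n IH; apply: measurable_trans_op => // x.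
exact: iter_trans_op_ge0.
Qed.

(** The law on the left is determined by its values on rectangles, on which it
    agrees with the image of the density f on the product of P and mu. *)
Lemma ge0_integral_disintegration d1 dS (S1 : measurableType d1)
    (S : measurableType dS) (m1 : {measure set S1 -> \bar R})
    (p1 : S1 -> S * T) (P : probability Omega R) (f : T -> T -> R)
    (Z : Omega -> S) (X : Omega -> T) (phi : S * T -> \bar R) :
  transition_density mu f -> measurable_fun setT p1 -> m1 setT < +oo ->
  measurable_fun setT Z -> measurable_fun setT X ->
  (forall A B, measurable A -> measurable B -> m1 (p1 @^-1` (A `*` B)) =
    \int[P]_(w in Z @^-1` A) \int[mu]_(y in B) (f (X w) y)%:E) ->
  measurable_fun setT phi -> (forall z, 0 <= phi z) ->
  \int[m1]_w phi (p1 w) =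
  \int[P]_w \int[mu]_y (phi (Z w, y) * (f (X w) y)%:E).
Proof.
move=> [mf f0 f1] mp1 m1fin mZ mX m1E mphi phi0.
pose h (z : Omega * T) := f (X z.1) z.2.
have mh : measurable_fun setT h.
  apply: (measurableT_comp mf (g := fun z => (X z.1, z.2))).
  by apply/measurable_fun_pair => //=; apply: measurableT_comp.
have h0 z : (0 <= h z)%R by exact: f0.
pose p2 (z : Omega * T) : S * T := (Z z.1, z.2).
have mp2 : measurable_fun setT p2.
  by apply/measurable_fun_pair => //=; apply: measurableT_comp.
transitivity (\int[density (P \x mu) mh h0]_z phi (p2 z)).
  apply: ge0_integral_transfer2 => // A B mA mB.
  rewrite m1E//.
  have mAB : measurable (p2 @^-1` (A `*` B)).
    by rewrite -[Y in measurable Y]setTI; apply: mp2 => //; exact: measurableX.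
  have mhE : measurable_fun setT (EFin \o h) by exact/measurable_EFinP.
  rewrite /= /density [RHS]integral_mkcond fubini_tonelli1; last 2 first.
  - by apply: (measurable_restrictT _ mAB).1; exact: measurable_funTS.
  - by move=> z; apply: erestrict_ge0 => y _; rewrite lee_fin.
  rewrite [LHS]integral_mkcond; apply: eq_integral => w _.
  rewrite /fubini_F patchE; case: ifPn => [/set_mem ZA|/negP ZA].
    rewrite [LHS]integral_mkcond; apply: eq_integral => y _; rewrite !patchE.
    congr (if _ then _ else _); apply/idP/idP; rewrite !inE; last by case.
    by move=> By; split.
  rewrite integral0_eq// => y _; rewrite patchE ifF//; apply/negP.
  by rewrite inE => -[/= ZA' _]; apply: ZA; rewrite inE.
rewrite integral_density; [|exact: measurableT_comp|by []].
rewrite fubini_tonelli1//.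
- by apply: emeasurable_funM; [exact: measurableT_comp|exact/measurable_EFinP].
- by move=> z; rewrite mule_ge0 ?lee_fin.
Qed.

Section process.
Variables (P : probability Omega R) (X : nat -> Omega -> T)
  (f : nat -> T -> T -> R).
Hypotheses (hf : forall n, transition_density mu (f n))
  (hM : markov_process mu P X f).

Lemma measurable_history n A : history X n A -> measurable A.
Proof.
suff : history X n `<=` measurable by apply.
apply: smallest_sub; first exact: sigma_algebra_measurable.
move=> _ [i [B [_ mB ->]]]; rewrite -[Y in measurable Y]setTI.
by apply: hM.1.
Qed.

Lemma history_measurable_fun i n E : (i <= n)%N -> measurable E ->
  history X n (X i @^-1` E).
Proof. by move=> le_in mE; apply: sub_sigma_algebra; exists i, E. Qed.

(** Z carries whatever is to be remembered of the past, such as a running sum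
    together with the current state. *)
Lemma markov_joint dS (S : measurableType dS) (Z : Omega -> S) n
    (phi : S * T -> \bar R) :
  (forall E, measurable E -> history X n (Z @^-1` E)) ->
  measurable_fun setT phi -> (forall z, 0 <= phi z) ->
  \int[P]_w phi (Z w, X n.+1 w) =
  \int[P]_w \int[mu]_y (phi (Z w, y) * (f n.+1 (X n w) y)%:E).
Proof.
move=> hZ; have mX k : measurable_fun setT (X k) by exact: hM.1.
have mZ : measurable_fun setT Z.
  by move=> _ E mE; rewrite setTI; exact: measurable_history (hZ _ mE).
apply: (ge0_integral_disintegration (p1 := fun w => (Z w, X n.+1 w))) => //.
- exact/measurable_fun_pair.
- by rewrite /= probability_setT ltry.
by move=> A B mA mB; rewrite -hM.2//; exact: hZ.
Qed.

Lemma markov_pair n (phi : T * T -> \bar R) :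
  measurable_fun setT phi -> (forall z, 0 <= phi z) ->
  \int[P]_w phi (X n w, X n.+1 w) =
  \int[P]_w \int[mu]_y (phi (X n w, y) * (f n.+1 (X n w) y)%:E).
Proof. by apply: markov_joint => E; exact: history_measurable_fun. Qed.

Lemma markov_step n h : measurable_fun setT h -> (forall x, 0 <= h x) ->
  \int[P]_w h (X n.+1 w) = \int[P]_w trans_op (f n.+1) h (X n w).
Proof.
move=> mh h0; apply: (markov_pair n (phi := fun z => h z.2)) => //.
exact: measurableT_comp.
Qed.

Lemma markov_iter f1 m n h : (forall j, (m <= j)%N -> f j.+1 = f1) ->
  measurable_fun setT h -> (forall x, 0 <= h x) ->
  \int[P]_w h (X (m + n)%N w) = \int[P]_w iter n (trans_op f1) h (X m w).
Proof.
move=> ff1; have hf1 : transition_density mu f1 by rewrite -(ff1 m).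
elim: n h => [|n IH] h mh h0; first by rewrite addn0.
rewrite addnS markov_step// ff1 ?leq_addr// IH ?iterSr//.
- exact: measurable_trans_op.
- by move=> x; exact: trans_op_ge0.
Qed.

End process.

End markov.

(** Invariance on sets extends to functions: it says that lambda is the second
    marginal of the law with density f with respect to lambda x mu. *)
Lemma invariant_trans_op (R : realType) d (T : measurableType d)
    (mu : {sigma_finite_measure set T -> \bar R})
    (lambda : probability T R) (f : T -> T -> R) (h : T -> \bar R) :
  transition_density mu f ->
  (forall B, measurable B ->
    lambda B = \int[lambda]_x \int[mu]_(y in B) (f x y)%:E) ->
  measurable_fun setT h -> (forall x, 0 <= h x) ->
  \int[lambda]_x h x = \int[lambda]_x trans_op mu f h x.
Proof.
move=> hf inv mh h0.
apply: (@ge0_integral_disintegration R d d T T mu d _ T unit lambda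
  (fun x => (tt, x)) lambda f (fun=> tt) idfun (fun z => h z.2)) => //.
- exact/measurable_fun_pair.
- by rewrite /= probability_setT ltry.
- exact: measurable_id.
- move=> A B _ mB; have [Att|Att] := pselect (A tt).
    rewrite (_ : _ @^-1` (A `*` B) = B); last first.
      by apply/seteqP; split => [x []//|x Bx]; split.
    rewrite (_ : _ @^-1` A = setT); first exact: inv.
    by apply/seteqP; split.
  rewrite (_ : _ @^-1` (A `*` B) = set0); last first.
    by apply/seteqP; split => // x [].
  rewrite (_ : _ @^-1` A = set0); first by rewrite measure0 integral_set0.
  by apply/seteqP; split.
- exact: measurableT_comp.
Qed.

(** * Homogeneous chains and the change-point model *)

Section chain.
Context (R : realType) (d dO : measure_display)
  (T : measurableType d) (Omega : measurableType dO).
Variables (mu : {sigma_finite_measure set T -> \bar R}) (f : T -> T -> R).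
Hypothesis hf : transition_density mu f.
Variables (X : nat -> Omega -> T) (Px : T -> probability Omega R).
Hypothesis hPx : started_chain mu f X Px.

Definition evol n (h : T -> \bar R) (x : T) : \bar R := \int[Px x]_w h (X n w).

Lemma measurable_chain n : measurable_fun setT (X n).
Proof. by have [[+ _] _] := hPx point; exact. Qed.

Lemma evol_ge0 n h x : (forall x, 0 <= h x) -> 0 <= evol n h x.
Proof. by move=> h0; apply: integral_ge0. Qed.

Lemma evol0 h x : measurable_fun setT h -> (forall x, 0 <= h x) ->
  evol 0 h x = h x.
Proof.
move=> mh h0; rewrite -[RHS]mul1e -(_ : \d_x setT = 1); last first.
  by rewrite diracT.
rewrite -integral_dirac//.
apply: (ge0_integral_transfer (m2 := \d_x) (p2 := idfun)) => //.
- exact: measurable_chain.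
- exact: measurable_id.
- by move=> E mE; have [_ H] := hPx x; exact: H.
Qed.

Lemma evolE n h x : measurable_fun setT h -> (forall x, 0 <= h x) ->
  evol n h x = iter n (trans_op mu f) h x.
Proof.
move=> mh h0; have [hM _] := hPx x.
have := markov_iter (fun=> hf) hM (m := 0) (f1 := f) n (fun _ _ => erefl)
  mh h0.
rewrite add0n /evol => ->; apply: evol0; first exact: measurable_iter_trans_op.
by move=> y; exact: iter_trans_op_ge0.
Qed.

Lemma measurable_evol n h : measurable_fun setT h -> (forall x, 0 <= h x) ->
  measurable_fun setT (evol n h).
Proof.
move=> mh h0; rewrite (_ : evol n h = iter n (trans_op mu f) h).
  exact: measurable_iter_trans_op.
by apply/funext => x; exact: evolE.
Qed.

Lemma evol1 h x : measurable_fun setT h -> (forall x, 0 <= h x) ->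
  evol 1 h x = trans_op mu f h x.
Proof. exact: (evolE 1). Qed.

Lemma trans_op_evol n h x : measurable_fun setT h -> (forall x, 0 <= h x) ->
  trans_op mu f (evol n h) x = evol n.+1 h x.
Proof.
move=> mh h0; rewrite [RHS]evolE//= (_ : evol n h = iter n (trans_op mu f) h)//.
by apply/funext => y; exact: evolE.
Qed.

Lemma evol_evol1 n h x : measurable_fun setT h -> (forall x, 0 <= h x) ->
  evol 1 (evol n h) x = evol n.+1 h x.
Proof.
move=> mh h0; rewrite evol1 ?trans_op_evol//; first exact: measurable_evol.
by move=> y; exact: evol_ge0.
Qed.

Lemma evol_invariant (lambda : probability T R) n h :
  (forall B, measurable B ->
    lambda B = \int[lambda]_x \int[mu]_(y in B) (f x y)%:E) ->
  measurable_fun setT h -> (forall x, 0 <= h x) ->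
  \int[lambda]_x evol n h x = \int[lambda]_x h x.
Proof.
move=> inv mh h0; elim: n => [|n IH].
  by apply: eq_integral => x _; exact: evol0.
rewrite -IH [RHS](invariant_trans_op hf inv)//.
- by apply: eq_integral => x _; rewrite trans_op_evol.
- exact: measurable_evol.
- by move=> y; exact: evol_ge0.
Qed.

Definition pair_mean (psi : T * T -> \bar R) (x : T) : \bar R :=
  \int[mu]_y (psi (x, y) * (f x y)%:E).

Lemma pair_mean_ge0 psi x : (forall z, 0 <= psi z) -> 0 <= pair_mean psi x.
Proof.
move=> psi0; have [_ f0 _] := hf; apply: integral_ge0 => y _.
by rewrite mule_ge0// lee_fin.
Qed.

Lemma measurable_pair_mean psi : measurable_fun setT psi ->
  (forall z, 0 <= psi z) -> measurable_fun setT (pair_mean psi).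
Proof.
move=> mpsi psi0.
exact: (measurable_kernel_integral (X := idfun) hf (@measurable_id _ _ _)).
Qed.

Lemma evol_pair n psi x : measurable_fun setT psi -> (forall z, 0 <= psi z) ->
  \int[Px x]_w psi (X n w, X n.+1 w) = evol n (pair_mean psi) x.
Proof.
move=> mpsi psi0; have [hM _] := hPx x.
exact: (markov_pair (fun=> hf) hM).
Qed.

End chain.

Section change_point.
Context (R : realType) (d dO : measure_display)
  (T : measurableType d) (Omega : measurableType dO).
Variables (mu : {sigma_finite_measure set T -> \bar R}) (f0 f1 : T -> T -> R).
Hypotheses (hf0 : transition_density mu f0) (hf1 : transition_density mu f1).
Variables (X : nat -> Omega -> T) (P : option nat -> probability Omega R).
Hypothesis hP : change_point_model mu f0 f1 X P.
Variable (Px : T -> probability Omega R).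
Hypothesis hPx : started_chain mu f1 X Px.

Lemma change_density_transition nu n :
  transition_density mu (change_density f0 f1 nu n).
Proof. by rewrite /change_density; case: nu => [k|] //; case: ifP. Qed.

Let hM nu : markov_process mu (P nu) X (change_density f0 f1 nu).
Proof. exact: hP.1. Qed.

Lemma pre_change_law k j h : (j <= k)%N ->
  measurable_fun setT h -> (forall x, 0 <= h x) ->
  \int[P (Some k)]_w h (X j w) = \int[P None]_w h (X j w).
Proof.
elim: j h => [|j IH] h jk mh h0.
  apply: ge0_integral_transfer => //; [exact: (hM None).1|exact: (hM None).1|].
  by move=> E mE; exact: hP.2.
rewrite !(markov_step (change_density_transition _) (hM _))// /change_density jk.
by apply: IH => //; [exact: ltnW|exact: measurable_trans_op|
  move=> x; exact: trans_op_ge0].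
Qed.

(** Up to the change point both models have the same one-dimensional laws, and
    from then on the chain is run afresh from X_k: what depends on k is the law
    of X_k without change. *)
Lemma post_change_law k n h : measurable_fun setT h -> (forall x, 0 <= h x) ->
  \int[P (Some k)]_w h (X (k + n)%N w) = \int[P None]_w evol X Px n h (X k w).
Proof.
move=> mh h0.
rewrite (markov_iter (change_density_transition _) (hM _) (f1 := f1))//; last first.
  by move=> j kj; rewrite /change_density ltnNge kj.
rewrite (pre_change_law (leqnn k)); last 2 first.
- exact: measurable_iter_trans_op.
- by move=> x; exact: iter_trans_op_ge0.
by apply: eq_integral => w _; rewrite (evolE hf1 hPx).
Qed.

Lemma post_change_pair k n psi : measurable_fun setT psi ->
  (forall z, 0 <= psi z) ->
  \int[P (Some k)]_w psi (X (k + n)%N w, X (k + n).+1 w) =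
  \int[P None]_w \int[Px (X k w)]_w' psi (X n w', X n.+1 w').
Proof.
move=> mpsi psi0.
rewrite (markov_pair (change_density_transition _) (hM _))//.
rewrite {1}/change_density ltnNge leq_addr/=.
rewrite -[LHS]/(\int[P (Some k)]_w pair_mean mu f1 psi (X (k + n)%N w)).
rewrite post_change_law.
- by apply: eq_integral => w _; rewrite (evol_pair hf1 hPx).
- exact: measurable_pair_mean.
- by move=> x; exact: pair_mean_ge0.
Qed.

End change_point.

(** * Moments of martingales *)

Section martingale_moment.
Context (R : realType) (dO : measure_display) (Omega : measurableType dO).
Variables (P : probability Omega R) (r : R) (dM : nat -> Omega -> R) (K : R).
Hypotheses (r2 : (2 < r)%R) (K0 : (0 <= K)%R).
Hypothesis mdM : forall j, measurable_fun setT (dM j).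
Hypothesis dMK : forall j, \int[P]_w (`|dM j w| `^ r)%:E <= K%:E.

Let M (n : nat) (w : Omega) : R := (\sum_(j < n) dM j w)%R.
Let phi j (w : Omega) : R := (`|M j w| `^ (r - 2) * M j w * dM j w)%R.

Hypothesis orth : forall j, P.-integrable setT (fun w => (phi j w)%:E) ->
  \int[P]_w (phi j w)%:E = 0.

Let mM n : measurable_fun setT (M n).
Proof. exact: measurable_sum. Qed.

Let mpow (f : Omega -> R) s : measurable_fun setT f ->
  measurable_fun setT (fun w => `|f w| `^ s)%R.
Proof.
move=> mf; apply: (measurableT_comp (measurable_powR s)).
exact: measurableT_comp.
Qed.

Let integrable_pow (f : Omega -> R) : measurable_fun setT f ->
  \int[P]_w (`|f w| `^ r)%:E < +oo ->
  P.-integrable setT (fun w => (`|f w| `^ r)%:E).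
Proof.
move=> mf fin; apply/integrableP; split; first exact/measurable_EFinP/mpow.
by under eq_integral do rewrite abse_EFin ger0_norm ?powR_ge0//.
Qed.

Let dM_int j : P.-integrable setT (fun w => (`|dM j w| `^ r)%:E).
Proof. by apply: integrable_pow => //; exact: le_lt_trans (dMK j) (ltry _). Qed.

Let MS n w : M n.+1 w = (M n w + dM n w)%R.
Proof. by rewrite /M big_ord_recr. Qed.

Let M_int n : P.-integrable setT (fun w => (`|M n w| `^ r)%:E).
Proof.
elim: n => [|n IH].
  under eq_fun do rewrite /M big_ord0 normr0 powR0 ?gt_eqF ?(lt_trans _ r2)//.
  exact: integrable0.
apply: (@le_integrable _ _ _ P setT measurableT _
    (fun w => (2 `^ r)%:E * ((`|M n w| `^ r)%:E + (`|dM n w| `^ r)%:E))).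
- exact/measurable_EFinP/mpow.
- move=> w _; rewrite -EFinD -EFinM !abse_EFin lee_fin.
  rewrite ger0_norm ?powR_ge0// MS.
  apply: le_trans (ler_norm _); apply: powR_normD; exact: le_trans (ltW r2).
- by apply: integrableZl => //; exact: integrableD.
Qed.

Let phi_int j : P.-integrable setT (fun w => (phi j w)%:E).
Proof.
apply: (@le_integrable _ _ _ P setT measurableT _
    (fun w => (`|M j w| `^ r)%:E + (`|dM j w| `^ r)%:E)).
- apply/measurable_EFinP; apply: measurable_funM => //.
  by apply: measurable_funM => //; exact: mpow.
- move=> w _; rewrite -EFinD !abse_EFin lee_fin.
  rewrite [leRHS]ger0_norm ?addr_ge0 ?powR_ge0//.
  rewrite /phi !normrM [X in (X * _ * _)%R]ger0_norm ?powR_ge0//.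
  have r20 : (0 <= r - 2)%R by rewrite subr_ge0 ltW.
  rewrite !(powR_split r2)// -mulrA !expr2.
  have [h|/ltW h] := leP `|dM j w|%R `|M j w|%R.
    apply: (@le_trans _ _ (`|M j w| `^ (r - 2) * (`|M j w| * `|M j w|))%R).
      by rewrite ler_wpM2l ?powR_ge0// ler_wpM2l.
    by rewrite lerDl mulr_ge0 ?powR_ge0// mulr_ge0.
  apply: (@le_trans _ _ (`|dM j w| `^ (r - 2) * (`|dM j w| * `|dM j w|))%R).
    apply: ler_pM; [exact: powR_ge0|exact: mulr_ge0|exact: ler_powRl|].
    by rewrite ler_wpM2r.
  by rewrite lerDr mulr_ge0 ?powR_ge0// mulr_ge0.
- exact: integrableD.
Qed.

Definition martingale_cst : R :=
  (expR (smooth_cst r) * (2 * smooth_cst r))%R.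

(** The expansion of the power turns E|M_j|^r into a recursion whose first-order
    term vanishes by orthogonality.  With n steps in view, its growth rate c / n
    multiplies to at most e^c, and its n sources of size n ^ (r / 2 - 1) add up
    to n ^ (r / 2). *)
Lemma martingale_moment n : (0 < n)%N ->
  \int[P]_w (`|M n w| `^ r)%:E <= (martingale_cst * n%:R `^ (r / 2) * K)%:E.
Proof.
move=> n0; pose u j := Rintegral P setT (fun w => `|M j w| `^ r)%R.
have uE j : \int[P]_w (`|M j w| `^ r)%:E = (u j)%:E.
  by rewrite /u /Rintegral fineK//; exact: integrable_fin_num.
rewrite uE lee_fin.
pose c := smooth_cst r; pose s := (n%:R `^ (r / 2 - 1) : R)%R.
have c0 : (0 <= c)%R by apply: smooth_cst_ge0; exact: le_trans (ltW r2).
have n1 : (1 <= n%:R :> R)%R by rewrite ler1n.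
have s0 : (0 <= s)%R by exact: powR_ge0.
have := @discrete_gronwall R c (2 * c * s * K) n u c0.
move=> /(_ _ _ _)/le_trans; apply.
- by rewrite !mulr_ge0.
- rewrite /u; under eq_Rintegral do
    rewrite /M big_ord0 normr0 powR0 ?gt_eqF ?(lt_trans _ r2)//.
  by rewrite Rintegral_cst// mul0r.
- move=> j _.
  pose f1 w := ((1 + c / n%:R) * `|M j w| `^ r)%R.
  pose f2 w := (r * phi j w)%R.
  pose f3 w := (2 * c * s * `|dM j w| `^ r)%R.
  have i1 : P.-integrable setT (EFin \o f1).
    exact: (integrableZl measurableT (1 + c / n%:R)%R (M_int j)).
  have i2 : P.-integrable setT (EFin \o f2).
    exact: (integrableZl measurableT r (phi_int j)).
  have i3 : P.-integrable setT (EFin \o f3).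
    exact: (integrableZl measurableT (2 * c * s)%R (dM_int j)).
  have i12 : P.-integrable setT (EFin \o (f1 \+ f2)%R).
    exact: (integrableD measurableT i1 i2).
  have i123 : P.-integrable setT (EFin \o ((f1 \+ f2) \+ f3)%R).
    exact: (integrableD measurableT i12 i3).
  apply: (@le_trans _ _ (Rintegral P setT ((f1 \+ f2) \+ f3)%R)).
    apply: le_Rintegral; [by []|exact: (M_int j.+1)|exact: i123|].
    move=> w _; rewrite MS.
    apply: (le_trans (powRD_increment _ _ r2 n1)).
    by rewrite /f1 /f2 /f3 /phi /= !mulrA.
  rewrite RintegralD// RintegralD// !RintegralZl//; last 3 first.
  - exact: dM_int.
  - exact: phi_int.
  - exact: M_int.
  have -> : Rintegral P setT (phi j) = 0%R.
    by rewrite /Rintegral orth.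
  rewrite mulr0 addr0 lerD2l ler_wpM2l ?mulr_ge0//.
  rewrite -lee_fin /Rintegral fineK; first exact: dMK.
  exact: integrable_fin_num.
- rewrite /martingale_cst -/c.
  have -> : (n%:R `^ (r / 2) = n%:R * s :> R)%R.
    by rewrite /s mulr_powRB1// divr_gt0// (lt_trans _ r2).
  by rewrite le_eqVlt; apply/orP; left; apply/eqP; ring.
Qed.

End martingale_moment.

(** * Moment inequalities and relative entropy *)

Section power_integrals.
Context (R : realType).

Lemma integral_probability_cst dO (Omega : measurableType dO)
  (P : probability Omega R) (k : \bar R) : \int[P]__ k = k.
Proof.
rewrite (_ : (fun=> k) = cst k)// integral_cst// -[RHS]mule1; congr (_ * _).
exact: probability_setT.
Qed.

(** Integrate the tangent inequality at the mean.  An infinite mean is read as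
    0, for which the inequality is trivial. *)
Lemma jensen_powR dO (Omega : measurableType dO) (P : probability Omega R)
    (r : R) (h : Omega -> R) :
  (1 < r)%R -> measurable_fun setT h -> (forall w, 0 <= h w)%R ->
  ((fine (\int[P]_w (h w)%:E)) `^ r)%:E <= \int[P]_w (h w `^ r)%:E.
Proof.
move=> r1 mh h0; have r0 : (0 < r)%R by exact: lt_trans r1.
have I0 : 0 <= \int[P]_w (h w)%:E by apply: integral_ge0 => w _; rewrite lee_fin.
have J0 : 0 <= \int[P]_w (h w `^ r)%:E.
  by apply: integral_ge0 => w _; rewrite lee_fin powR_ge0.
have [Ioo|Ifin] := eqVneq (\int[P]_w (h w)%:E) +oo.
  by rewrite Ioo /= powR0 ?gt_eqF.
set a := fine _; have a0 : (0 <= a)%R by exact: fine_ge0.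
have aE : \int[P]_w (h w)%:E = a%:E.
  by rewrite /a fineK// ge0_fin_numE// ltey.
have mhr : measurable_fun setT (fun w => (h w `^ r)%:E).
  by apply/measurable_EFinP; exact: (measurableT_comp (measurable_powR r)).
have mhE : measurable_fun setT (fun w => (h w)%:E) by exact/measurable_EFinP.
have hE0 w : @setT Omega w -> 0 <= (h w)%:E by rewrite lee_fin.
have hrE0 w : @setT Omega w -> 0 <= (h w `^ r)%:E.
  by rewrite lee_fin powR_ge0.
have ra0 : (0 <= r * a `^ (r - 1))%R by rewrite mulr_ge0 ?powR_ge0 ?ltW.
have ra1 : (0 <= (r - 1) * a `^ r)%R by rewrite mulr_ge0 ?powR_ge0 ?subr_ge0 ?ltW.
have : \int[P]_w ((r * a `^ (r - 1))%:E * (h w)%:E) <=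
    \int[P]_w ((h w `^ r)%:E + ((r - 1) * a `^ r)%:E).
  apply: ge0_le_integral => //.
  - by move=> w _; rewrite mule_ge0 ?lee_fin.
  - exact: measurable_funeM.
  - exact: emeasurable_funD.
  - by move=> w _; rewrite -EFinM -EFinD lee_fin powR_tangent.
rewrite ge0_integralZl// ge0_integralD//.
rewrite integral_probability_cst aE.
rewrite -EFinM -mulrA [X in (r * X)%R]mulrC mulr_powRB1//.
move: J0; case: (\int[P]_w (h w `^ r)%:E) => [b||//]; last first.
  by move=> *; rewrite leey.
by rewrite -EFinD !lee_fin => _; lra.
Qed.

Lemma powR_sum_le (r : R) n (a : nat -> R) : (0 < r)%R ->
  (`|\sum_(i < n) a i| `^ r <= (2 `^ r) ^+ n * \sum_(i < n) `|a i| `^ r)%R.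
Proof.
move=> r0; have q1 : (1 <= 2 `^ r :> R)%R.
  by rewrite -[leLHS](powRr0 2); rewrite ler_powR ?(ltW r0)// ler1n.
elim: n => [|n IH]; first by rewrite !big_ord0 normr0 powR0 ?gt_eqF// mulr0.
rewrite !big_ord_recr/=; apply: le_trans (powR_normD _ _ (ltW r0)) _.
rewrite exprS -mulrA ler_wpM2l ?powR_ge0// mulrDr lerD//.
by rewrite ler_peMl ?powR_ge0// exprn_ege1.
Qed.

End power_integrals.

(** Relative entropy is nonnegative, with an integrable log-likelihood ratio as
    soon as it is finite: log t >= 1 - 1 / t bounds the integrand from below by
    f1 - f0. *)
Section relative_entropy.
Context (R : realType) (d : measure_display) (T : measurableType d).
Variables (mu : {sigma_finite_measure set T -> \bar R}) (f0 f1 : T -> T -> R).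
Hypotheses (hf0 : transition_density mu f0) (hf1 : transition_density mu f1).
Hypothesis hsupp : forall x y, (0 < f0 x y)%R <-> (0 < f1 x y)%R.

Lemma llrE x y : llr f0 f1 y x = (ln (f1 x y) - ln (f0 x y))%R.
Proof.
have [_ f00 _] := hf0; have [_ f10 _] := hf1.
have [f1x|f1x] := ltP 0%R (f1 x y).
  by rewrite /llr ln_div// posrE ?hsupp// ; apply/hsupp.
have f0x : (f0 x y <= 0)%R.
  by rewrite leNgt; apply/negP => /hsupp; rewrite ltNge f1x.
rewrite /llr; have -> : f1 x y = 0%R by apply/eqP; rewrite eq_le f1x f10.
have -> : f0 x y = 0%R by apply/eqP; rewrite eq_le f0x f00.
by rewrite mul0r ln0// subrr.
Qed.

Lemma measurable_llr :
  measurable_fun setT (fun z : T * T => llr f0 f1 z.2 z.1).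
Proof.
have [mf0 _ _] := hf0; have [mf1 _ _] := hf1.
rewrite (_ : (fun z => _) =
    fun z : T * T => (ln (f1 z.1 z.2) - ln (f0 z.1 z.2))%R); last first.
  by apply/funext => z; exact: llrE.
by apply: measurable_funB; apply: (measurableT_comp (@measurable_ln R)).
Qed.

Lemma llr_ge x y : (f1 x y - f0 x y <= llr f0 f1 y x * f1 x y)%R.
Proof.
have [_ f00 _] := hf0; have [_ f10 _] := hf1.
have [f1x|f1x] := ltP 0%R (f1 x y); last first.
  have -> : f1 x y = 0%R by apply/eqP; rewrite eq_le f1x f10.
  by rewrite mulr0 sub0r oppr_le0.
have f0x : (0 < f0 x y)%R by apply/hsupp.
have : (ln (1 + (f0 x y / f1 x y - 1)) <= f0 x y / f1 x y - 1)%R.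
  by rewrite le_ln1Dx// ltrBrDr addNr divr_gt0.
rewrite addrC subrK -invf_div lnV ?posrE ?divr_gt0// -/(llr f0 f1 y x).
rewrite invf_div -(ler_pM2r f1x) mulrBl divfK ?gt_eqF//; lra.
Qed.

Lemma llr_integrable x : mean_llr mu f0 f1 x < +oo ->
  mu.-integrable setT (fun y => (llr f0 f1 y x * f1 x y)%:E).
Proof.
have [mf0 f00 f0_1] := hf0; have [mf1 f10 f1_1] := hf1.
have ms (f : T -> T -> R) : measurable_fun setT (fun z : T * T => f z.1 z.2) ->
    measurable_fun setT (f x).
  move=> mf; apply: (measurableT_comp mf (g := fun y => (x, y))).
  exact/measurable_fun_pair.
have mg : measurable_fun setT (fun y => (llr f0 f1 y x * f1 x y)%:E).
  apply/measurable_EFinP; apply: measurable_funM; last exact: ms.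
  exact: (ms (fun x y => llr f0 f1 y x) measurable_llr).
move=> fin; set g := (fun y => _) in mg *.
have neg : \int[mu]_y (g^\- y) <= 1.
  rewrite -(f0_1 x); apply: ge0_le_integral => //.
  - exact: measurable_funeneg.
  - by apply/measurable_EFinP; exact: ms.
  - move=> y _; rewrite funenegE /g -EFinN -EFin_max lee_fin.
    by rewrite ge_max f00 andbT; have := llr_ge x y; have := f10 x y; lra.
have neg_fin : \int[mu]_y (g^\- y) \is a fin_num.
  rewrite ge0_fin_numE ?(le_lt_trans neg) ?ltry//.
  by apply: integral_ge0 => y _; exact: funeneg_ge0.
have pos : \int[mu]_y (g^\+ y) < +oo.
  move: fin; rewrite /mean_llr integralE -/g lteBlDr// addye//.
  by apply/eqP => H; rewrite H in neg_fin.
apply/integrableP; split => //.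
rewrite -/(abse \o g) fune_abse.
rewrite ge0_integralD//; last 2 first.
- exact: measurable_funepos.
- exact: measurable_funeneg.
by rewrite lte_add_pinfty// (le_lt_trans neg)// ltry.
Qed.

Lemma mean_llr_ge0 x : mean_llr mu f0 f1 x < +oo -> 0 <= mean_llr mu f0 f1 x.
Proof.
have [mf0 f00 f0_1] := hf0; have [mf1 f10 f1_1] := hf1.
move=> fin.
have If (f : T -> T -> R) : transition_density mu f ->
    mu.-integrable setT (fun y => (f x y)%:E).
  move=> [mf f_0 f_1]; apply/integrableP; split.
    apply/measurable_EFinP.
    apply: (measurableT_comp mf (g := fun y => (x, y))).
    exact/measurable_fun_pair.
  under eq_integral do rewrite abse_EFin ger0_norm//.
  by rewrite f_1 ltry.
have -> : 0 = \int[mu]_y ((f1 x y)%:E - (f0 x y)%:E).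
  by rewrite integralB//; [rewrite f1_1 f0_1 subee|exact: If|exact: If].
apply: le_integral => //.
- by apply: integrableB => //; exact: If.
- exact: llr_integrable.
- by move=> y _; rewrite -EFinB lee_fin llr_ge.
Qed.

End relative_entropy.

(** * Minorization and the stationary law *)

Section stationarity.
Context (R : realType) (d dO : measure_display)
  (T : measurableType d) (Omega : measurableType dO).
Variables (mu : {sigma_finite_measure set T -> \bar R}) (f : T -> T -> R).
Hypothesis hf : transition_density mu f.
Variables (X : nat -> Omega -> T) (Px : T -> probability Omega R).
Hypothesis hPx : started_chain mu f X Px.
Variables (p : nat) (C : set T) (fp : T -> T -> \bar R).
Hypotheses (mC : measurable C) (hfp : step_density mu X Px p fp).

(** On C the law of X_p has density at least c, so it dominates the measure of
    density c 1_C. *)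
Lemma minorization : 0 < ereal_inf [set fp x y | x in C & y in C] ->
  exists2 c : R, (0 < c)%R & forall x (h : T -> \bar R), C x ->
    measurable_fun setT h -> (forall y, 0 <= h y) ->
    c%:E * \int[mu]_(y in C) h y <= evol X Px p h x.
Proof.
move=> inf0.
have [c c0 cfp] : exists2 c : R, (0 < c)%R &
    forall x y, C x -> C y -> c%:E <= fp x y.
  have lb x y : C x -> C y -> ereal_inf [set fp x y | x in C & y in C] <= fp x y.
    by move=> Cx Cy; apply: ereal_inf_lbound; exists x => //; exists y.
  move: inf0 lb; case: ereal_inf => [c||//]; first by rewrite lte_fin; exists c.
  by move=> _ lb; exists 1%R => // x y Cx Cy; apply: le_trans (lb x y Cx Cy);
    rewrite leey.
exists c => // x h Cx mh h0.
have [mfp fp0 fpE] := hfp x.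
pose k (y : T) : R := (c * \1_C y)%R.
have mk : measurable_fun setT k.
  by apply: measurable_funM => //; exact: measurable_indic.
have k0 y : (0 <= k y)%R by rewrite mulr_ge0// ltW.
have -> : c%:E * \int[mu]_(y in C) h y = \int[density mu mk k0]_y h y.
  rewrite integral_density// [in LHS]integral_mkcond -ge0_integralZl//.
  - apply: eq_integral => y _; rewrite epatch_indic /k EFinM.
    by rewrite muleCA muleA.
  - by apply: (measurable_restrictT _ mC).1; exact: measurable_funTS.
  - by move=> y _; apply: erestrict_ge0 => z _.
  - by rewrite lee_fin ltW.
have mX : measurable_fun setT (X p) by exact: measurable_chain hPx p.
have /= E := ge0_integral_pushforward mX (Px x) measurableT mh (in1W h0).
rewrite /evol -E.
apply: ge0_le_measure_integral => // B mB.
rewrite /= /density -[leRHS]/(Px x (X p @^-1` B)) fpE//.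
apply: ge0_le_integral => //.
- by move=> y _; rewrite lee_fin.
- by apply/measurable_EFinP; exact: measurable_funTS.
- exact: measurable_funTS.
- move=> y _; rewrite /k indicE; case: (boolP (y \in C)) => [/set_mem Cy|_].
    by rewrite mulr1 cfp.
  by rewrite mulr0.
Qed.

Variable lambda : probability T R.
Hypothesis inv : forall B, measurable B ->
  lambda B = \int[lambda]_x \int[mu]_(y in B) (f x y)%:E.
Variables (V : T -> R) (rho D : R).
Hypotheses (mV : measurable_fun [set: T] V) (V1 : forall x, (1 <= V x)%R).
Hypotheses (rho0 : (0 < rho)%R) (rho1 : (rho < 1)%R) (D0 : (0 < D)%R).
Hypothesis drift : forall x,
  \int[Px x]_w (V (X p w))%:E <= ((1 - rho) * V x + D * \1_C x)%:E.

Let V0 x : (0 <= V x)%R. Proof. exact: le_trans (V1 x). Qed.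

Let mVE : measurable_fun setT (fun x => (V x)%:E).
Proof. exact/measurable_EFinP. Qed.

Let VE0 x : 0 <= (V x)%:E. Proof. by rewrite lee_fin. Qed.

Let rho1' : (0 <= 1 - rho)%R. Proof. by rewrite subr_ge0 ltW. Qed.

(** Truncating V at level N keeps every integral finite: invariance equates the
    integral of min(V, N) with that of its mean after p steps, while the drift
    gains rho V wherever V is at most N. *)
Lemma stationary_drift_bound N :
  \int[lambda]_(x in [set x | (V x <= N)%R]) (V x)%:E <= (D / rho)%:E.
Proof.
have [N0|N0] := leP 0%R N; last first.
  rewrite (_ : [set x | _] = set0); last first.
    apply/seteqP; split => // x /= VN; have := lt_le_trans N0 (V0 x).
    by rewrite ltNge VN.
  by rewrite integral_set0 lee_fin divr_ge0// ltW.
set B := [set x | _]; have mB : measurable B.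
  rewrite (_ : B = V @^-1` `]-oo, N]%classic); last first.
    by apply/seteqP; split => x /=; rewrite in_itv.
  by rewrite -[Y in measurable Y]setTI; exact: mV.
pose a x : R := Num.min ((1 - rho) * V x + D)%R N.
pose b x : R := Num.min (V x) N.
have ma : measurable_fun setT a.
  apply: measurable_minr => //; apply: measurable_funD => //.
  exact: measurable_funM.
have mb : measurable_fun setT b by exact: measurable_minr.
have maE : measurable_fun setT (fun x => (a x)%:E) by exact/measurable_EFinP.
have mbE : measurable_fun setT (fun x => (b x)%:E) by exact/measurable_EFinP.
have a0 x : (0 <= a x)%R.
  by rewrite le_min N0 andbT addr_ge0 ?mulr_ge0// ltW.
have b0 x : (0 <= b x)%R by rewrite le_min N0 V0.
have aN x : (a x <= N)%R by rewrite ge_min lexx orbT.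
have bN x : (b x <= N)%R by rewrite ge_min lexx orbT.
have ba : \int[lambda]_x (b x)%:E <= \int[lambda]_x (a x)%:E.
  rewrite -(evol_invariant hf hPx p inv mbE)//.
  apply: ge0_le_integral => //.
  - by move=> x _; apply: evol_ge0 => y; rewrite lee_fin.
  - by apply: (measurable_evol hf hPx) => // y; rewrite lee_fin.
  move=> x _; rewrite /a EFin_min le_min; apply/andP; split.
    apply: (@le_trans _ _ (\int[Px x]_w (V (X p w))%:E)).
      apply: ge0_le_integral_nonmeas => w; first by rewrite lee_fin.
      by rewrite lee_fin ge_min lexx.
    apply: (le_trans (drift x)); rewrite lee_fin lerD2l ler_piMr ?(ltW D0)//.
  rewrite -(integral_probability_cst (Px x) N%:E).
  by apply: ge0_le_integral_nonmeas => w; rewrite lee_fin.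
have bfin : \int[lambda]_x (b x)%:E \is a fin_num.
  rewrite ge0_fin_numE; last by apply: integral_ge0 => x _; rewrite lee_fin.
  apply: (@le_lt_trans _ _ N%:E); last exact: ltry.
  rewrite -(integral_probability_cst lambda N%:E).
  by apply: ge0_le_integral_nonmeas => w; rewrite lee_fin.
have mVB : measurable_fun setT (((fun x => (V x)%:E) \_ B)).
  by apply: (measurable_restrictT _ mB).1; exact: measurable_funTS.
have VB0 x : 0 <= ((fun x => (V x)%:E) \_ B) x by exact: erestrict_ge0.
have ab : \int[lambda]_x (a x)%:E + rho%:E * \int[lambda]_(x in B) (V x)%:E <=
    \int[lambda]_x (b x)%:E + D%:E.
  rewrite [X in _ + _ * X]integral_mkcond.
  rewrite -(integral_probability_cst lambda D%:E) -ge0_integralZl//; last first.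
    by rewrite lee_fin ltW.
  have aE0 x : @setT T x -> 0 <= (a x)%:E by rewrite lee_fin.
  have bE0 x : @setT T x -> 0 <= (b x)%:E by rewrite lee_fin.
  have DE0 x : @setT T x -> 0 <= D%:E by rewrite lee_fin ltW.
  have cE0 x : @setT T x -> 0 <= rho%:E * ((fun x => (V x)%:E) \_ B) x.
    by move=> _; rewrite mule_ge0// lee_fin ltW.
  have mc : measurable_fun setT (fun x => rho%:E * ((fun x => (V x)%:E) \_ B) x).
    exact: measurable_funeM.
  rewrite -!ge0_integralD//; apply: ge0_le_integral_nonmeas => x.
    by rewrite adde_ge0 ?aE0 ?cE0.
  (* min((1 - rho) V + D, N) + rho V 1_(V <= N) <= min(V, N) + D *)
  rewrite patchE; case: ifPn => [/set_mem Bx|/negP Bx].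
    rewrite -EFinM -!EFinD lee_fin /b (min_idPl Bx).
    by apply: (@le_trans _ _ ((1 - rho) * V x + D + rho * V x)%R);
      [rewrite lerD2r ge_min lexx|lra].
  rewrite mule0 adde0 -EFinD lee_fin /b (min_idPr _).
    by rewrite (le_trans (aN x))// lerDl ltW.
  by rewrite ltW// ltNge; apply/negP => h; apply: Bx; rewrite inE.
have : rho%:E * \int[lambda]_(x in B) (V x)%:E <= D%:E.
  rewrite -(leeD2lE _ _ bfin); apply: le_trans ab.
  by rewrite leeD2r.
by move=> H; rewrite EFinM lee_pdivlMr// muleC.
Qed.

Lemma stationary_Lyapunov : \int[lambda]_x (V x)%:E < +oo.
Proof.
apply: (@le_lt_trans _ _ (D / rho)%:E); last exact: ltry.
pose F (n : nat) := [set x | (V x <= n%:R)%R].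
have -> : [set: T] = \bigcup_n F n.
  apply/seteqP; split => // x _.
  by exists (Num.bound (V x)) => //=; apply: ltW; exact: (archi_boundP (V0 x)).
have mF n : measurable (F n).
  rewrite (_ : F n = V @^-1` `]-oo, n%:R]%classic); last first.
    by apply/seteqP; split => x /=; rewrite in_itv.
  by rewrite -[Y in measurable Y]setTI; exact: mV.
have ndF : nondecreasing_seq F.
  move=> n m nm; apply/subsetPset => x /= /le_trans; apply; by rewrite ler_nat.
have mVF n : measurable_fun (F n) (fun x => (V x)%:E).
  exact: measurable_funTS.
have /cvg_lim <- := @ge0_nondecreasing_set_cvg_integral _ _ _ F _ lambda ndF mF
  mVF (fun _ x _ => VE0 x) => //.
apply: lime_le; last by apply: nearW => n; exact: stationary_drift_bound.
apply: ereal_nondecreasing_is_cvgn.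
exact: (@ge0_nondecreasing_set_nondecreasing_integral _ _ _ F _ lambda ndF mF
  mVF (fun _ x _ => VE0 x)).
Qed.

(** Integrating the drift, V would lose the fraction rho of its positive
    integral if C carried no mass. *)
Lemma stationary_small_set_gt0 : 0 < lambda C.
Proof.
have lV1 : 1 <= \int[lambda]_x (V x)%:E.
  rewrite -(integral_probability_cst lambda 1%E).
  by apply: ge0_le_integral_nonmeas => x; rewrite lee_fin.
have Vfin : \int[lambda]_x (V x)%:E \is a fin_num.
  by rewrite ge0_fin_numE ?stationary_Lyapunov// integral_ge0.
have : \int[lambda]_x (V x)%:E <=
    (1 - rho)%:E * \int[lambda]_x (V x)%:E + D%:E * lambda C.
  rewrite -[leLHS](evol_invariant hf hPx p inv)//.
  have mC1 : measurable_fun setT (fun x => (\1_C x : R)%:E).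
    by apply/measurable_EFinP; exact: measurable_indic.
  have e1 x : @setT T x -> 0 <= (1 - rho)%:E * (V x)%:E.
    by move=> _; rewrite mule_ge0// lee_fin.
  have e2 x : @setT T x -> 0 <= D%:E * (\1_C x : R)%:E.
    by move=> _; rewrite mule_ge0 ?lee_fin// ltW.
  have D0' : 0 <= D%:E by rewrite lee_fin ltW.
  have -> : lambda C = \int[lambda]_x (\1_C x : R)%:E.
    by rewrite integral_indic// setIT.
  rewrite -ge0_integralZl//.
  rewrite -ge0_integralZl// -ge0_integralD//; last 2 first.
  - exact: measurable_funeM.
  - exact: measurable_funeM.
  apply: ge0_le_integral_nonmeas => x; first exact: evol_ge0.
  by rewrite -!EFinM -EFinD; exact: drift.
rewrite lt0e measure_ge0 andbT => H; apply/eqP => lC0; move: H.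
rewrite lC0 mule0 adde0 -(fineK Vfin) -EFinM lee_fin => H.
move: lV1; rewrite -(fineK Vfin) lee_fin => v1.
have := mulr_gt0 rho0 (lt_le_trans ltr01 v1); lra.
Qed.

End stationarity.

(** * Potential of the chain killed at regeneration *)

Section regeneration.
Context (R : realType) (d dO : measure_display)
  (T : measurableType d) (Omega : measurableType dO).
Variables (mu : {measure set T -> \bar R}) (P : T -> probability Omega R)
  (Y : Omega -> T).
Hypothesis mY : measurable_fun setT Y.
Hypothesis mP : forall h : T -> \bar R, measurable_fun setT h ->
  (forall x, 0 <= h x) -> measurable_fun setT (fun x => \int[P x]_w h (Y w)).
Variables (C : set T) (c rho D : R) (V : T -> R).
Hypotheses (mC : measurable C) (muC : mu C < +oo) (muC0 : 0 < mu C).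
Hypothesis c0 : (0 < c)%R.
Hypothesis minor : forall x (h : T -> \bar R), C x -> measurable_fun setT h ->
  (forall y, 0 <= h y) -> c%:E * \int[mu]_(y in C) h y <= \int[P x]_w h (Y w).
Hypotheses (mV : measurable_fun setT V) (V1 : forall x, (1 <= V x)%R).
Hypotheses (rho0 : (0 < rho)%R) (D0 : (0 < D)%R).
Hypothesis drift : forall x,
  \int[P x]_w (V (Y w))%:E <= ((1 - rho) * V x + D * \1_C x)%:E.

Let delta : R := (c * fine (mu C))%R.

Definition regen_bound (x : T) : R := ((V x + D / delta) / rho)%R.

Local Notation W := regen_bound.

Let delta0 : (0 < delta)%R.
Proof. by rewrite mulr_gt0// fine_gt0// muC0. Qed.

Let deltaE : delta%:E = c%:E * mu C.
Proof. by rewrite EFinM fineK// ge0_fin_numE. Qed.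

Let V0 x : (0 <= V x)%R. Proof. exact: le_trans (V1 x). Qed.

Let Dd0 : (0 <= D / delta)%R. Proof. by rewrite divr_ge0// ltW. Qed.

Let W_ge0 x : (0 <= W x)%R.
Proof. by rewrite divr_ge0 ?addr_ge0// ltW. Qed.

Let mW : measurable_fun setT W.
Proof. by apply: measurable_funM => //; apply: measurable_funD. Qed.

Let q (u : T -> R) x : R := fine (\int[P x]_w (u (Y w))%:E).
Let nu (u : T -> R) : R := fine (c%:E * \int[mu]_(y in C) (u y)%:E).
(** The kernel of the chain killed with intensity nu on C, which stands for its
    regeneration. *)
Let Q' (u : T -> R) x : R := (q u x - \1_C x * nu u)%R.

(** Functions of size W, on which all integrals below are finite. *)
Let adm (u : T -> R) : Prop := [/\ measurable_fun setT u,
  (forall x, 0 <= u x)%R & (forall x, u x <= W x)%R].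

Let mEY (u : T -> R) : measurable_fun setT u ->
  measurable_fun setT (fun w => (u (Y w))%:E).
Proof. by move=> mu'; apply/measurable_EFinP; exact: measurableT_comp. Qed.

Let mEu (u : T -> R) D' : measurable_fun setT u ->
  measurable_fun D' (fun x => (u x)%:E).
Proof. by move=> mu'; apply/measurable_EFinP; exact: measurable_funTS. Qed.

Let q_W x : \int[P x]_w (W (Y w))%:E <=
  (((1 - rho) * V x + D * \1_C x + D / delta) / rho)%:E.
Proof.
have mVY := mEY mV.
have VY0 w : setT w -> 0 <= (V (Y w))%:E by rewrite lee_fin.
have Dd0' w : @setT Omega w -> 0 <= (D / delta)%:E by rewrite lee_fin.
have -> : \int[P x]_w (W (Y w))%:E =
    (rho^-1)%:E * (\int[P x]_w (V (Y w))%:E + (D / delta)%:E).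
  rewrite -[in RHS](mule1 (D / delta)%:E) -(@probability_setT _ _ _ (P x)).
  rewrite -integral_cst// -ge0_integralD// -ge0_integralZl//.
  - by apply: eq_integral => w _; rewrite -EFinD -EFinM mulrC.
  - exact: emeasurable_funD.
  - by move=> w _; rewrite -EFinD lee_fin addr_ge0.
  - by rewrite lee_fin invr_ge0 ltW.
rewrite [X in _ <= X%:E]mulrC [leRHS]EFinM lee_pmul2l ?lte_fin ?invr_gt0//.
by rewrite EFinD leeD2r.
Qed.

Let q_fin u x : adm u -> \int[P x]_w (u (Y w))%:E = (q u x)%:E.
Proof.
move=> [mu' u0 uW]; rewrite /q fineK// ge0_fin_numE; last first.
  by apply: integral_ge0 => w _; rewrite lee_fin.
apply: (@le_lt_trans _ _ (\int[P x]_w (W (Y w))%:E)).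
  apply: ge0_le_integral => //; [|exact: mEY|exact: mEY|].
  - by move=> w _; rewrite lee_fin.
  - by move=> w _; rewrite lee_fin.
exact: le_lt_trans (q_W x) (ltry _).
Qed.

Let C_ne : C !=set0.
Proof.
by apply/set0P/eqP => C0; move: muC0; rewrite C0 measure0 ltxx.
Qed.

Let nu_fin u : adm u -> c%:E * \int[mu]_(y in C) (u y)%:E = (nu u)%:E.
Proof.
move=> au; have [mu' u0 uW] := au; rewrite /nu fineK// ge0_fin_numE; last first.
  rewrite mule_ge0 ?lee_fin ?(ltW c0)//.
  by apply: integral_ge0 => y _; rewrite lee_fin.
have [x Cx] := C_ne.
apply: (@le_lt_trans _ _ (q u x)%:E); last exact: ltry.
rewrite -q_fin//; by apply: (minor Cx) => //; exact: mEu.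
Qed.

Let Q'_ge0 u x : adm u -> (0 <= Q' u x)%R.
Proof.
move=> au; have [mu' u0 uW] := au; rewrite /Q' indicE.
case: (boolP (x \in C)) => [/set_mem Cx|_] /=.
  rewrite mul1r subr_ge0 -lee_fin -q_fin// -nu_fin//.
  by apply: minor => //; exact: mEu.
rewrite mul0r subr0 -lee_fin -q_fin//.
by apply: integral_ge0 => w _; rewrite lee_fin.
Qed.

Let Q'_D u v x : adm u -> adm v -> (forall x, u x + v x <= W x)%R ->
  Q' (u \+ v)%R x = (Q' u x + Q' v x)%R.
Proof.
move=> au av uvW; have [[mu' u0 uW] [mv v0 vW]] := (au, av).
have auv : adm (u \+ v)%R.
  by split => //; [exact: measurable_funD|move=> y; exact: addr_ge0].
have qD : (q (u \+ v) x = q u x + q v x)%R.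
  apply: EFin_inj; rewrite EFinD -!q_fin//=.
  by rewrite -ge0_integralD//; solve [exact: mEY|move=> w _; rewrite lee_fin//].
have nD : (nu (u \+ v) = nu u + nu v)%R.
  apply: EFin_inj; rewrite EFinD -!nu_fin//= -ge0_muleDr; last 2 first.
  - by apply: integral_ge0 => w _; rewrite lee_fin.
  - by apply: integral_ge0 => w _; rewrite lee_fin.
  by rewrite -ge0_integralD//; solve [exact: mEu|move=> w _; rewrite lee_fin//].
by rewrite /Q' qD nD; ring.
Qed.

Let Q'_le u v x : adm u -> adm v -> (forall x, u x <= v x)%R ->
  (Q' u x <= Q' v x)%R.
Proof.
move=> au av uv; have [[mu' u0 uW] [mv v0 vW]] := (au, av).
have auv : adm (v \- u)%R.
  split; first exact: measurable_funB.
  - by move=> y /=; rewrite subr_ge0.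
  - by move=> y /=; rewrite (le_trans _ (vW y))// gerBl.
have -> : v = (u \+ (v \- u))%R by apply/funext => y /=; rewrite addrC subrK.
rewrite Q'_D//; last by move=> y /=; rewrite addrC subrK.
by rewrite lerDl Q'_ge0.
Qed.

Let adm_W : adm W. Proof. by split. Qed.

(** On C, the operator Q' lowers a constant by delta times that constant: adding
    D / delta to V repays exactly the term D of the drift. *)
Let Q'_W x : (V x + Q' W x <= W x)%R.
Proof.
have nuW : (D / rho <= nu W)%R.
  rewrite -lee_fin -nu_fin//.
  have -> : (D / rho)%:E = c%:E * \int[mu]_(y in C) (cst (D / delta / rho)%:E) y.
    rewrite integral_cst// muleCA -deltaE -EFinM; congr EFin.
    by rewrite mulrAC divfK// gt_eqF.
  rewrite lee_pmul2l ?lte_fin//; apply: ge0_le_integral => //.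
  - by move=> y _; rewrite lee_fin divr_ge0 ?(ltW rho0).
  - exact: mEu.
  - by move=> y _; rewrite lee_fin ler_pM2r ?invr_gt0// lerDr.
have := q_W x; rewrite q_fin// lee_fin => qW.
rewrite /Q'; set i := \1_C x in qW *.
have i0 : (0 <= i)%R by [].
have iN : (i * (D / rho) <= i * nu W)%R by rewrite ler_wpM2l.
have -> : W x = (V x + ((1 - rho) * V x + D * i + D / delta) / rho
   - i * (D / rho))%R.
  by rewrite /W; field; rewrite !gt_eqF.
lra.
Qed.

Section potential.
Variable h : T -> R.
Hypotheses (mh : measurable_fun setT h) (h0 : forall x, (0 <= h x)%R)
  (hV : forall x, (h x <= V x)%R).

Let Sn (n : nat) : T -> R := iter n (fun u x => (h x + Q' u x)%R) (cst 0%R).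

Let Sn_adm n : adm (Sn n).
Proof.
elim: n => [|n IH]; first by split => //; exact: measurable_cst.
split.
- rewrite /=; apply: measurable_funD => //; apply: measurable_funB.
    have [mS S0 _] := IH.
    apply: (measurableT_comp (fine_measurable measurableT)).
    apply: (mP (h := fun y => (Sn n y)%:E)); first exact: mEu.
    by move=> x; rewrite lee_fin.
  by apply: measurable_funM => //; exact: measurable_indic.
- by move=> x /=; rewrite addr_ge0// Q'_ge0.
- move=> x /=; apply: le_trans (Q'_W x); rewrite lerD//; apply: Q'_le => //.
  by case: IH.
Qed.

Let Sn_nd x : nondecreasing_seq (fun n => (Sn n x)%:E).
Proof.
apply/nondecreasing_seqP => n; rewrite lee_fin.
elim: n x => [|n IH] x; first by have [_ + _] := Sn_adm 1; exact.
rewrite /= lerD2l.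
by apply: Q'_le; [exact: (Sn_adm n)|exact: (Sn_adm n.+1)|exact: IH].
Qed.

(** The partial potentials S_(n+1) = h + Q' S_n increase and stay below W.  The
    identity has its subtracted term moved to the left, so that it passes to the
    limit by monotone convergence of nonnegative quantities. *)
Lemma regeneration_potential : exists A : T -> R,
  [/\ measurable_fun setT A, (forall x, (0 <= A x)%R),
      (forall x, (A x <= W x)%R) &
      forall x, (A x)%:E + (\1_C x)%:E * (c%:E * \int[mu]_(y in C) (A y)%:E) =
        (h x)%:E + \int[P x]_w (A (Y w))%:E].
Proof.
pose Ae x := limn (fun n => (Sn n x)%:E).
have cvgA x : (fun n => (Sn n x)%:E) @ \oo --> Ae x.
  exact: ereal_nondecreasing_is_cvgn (Sn_nd x).
have Ae0 x : 0 <= Ae x.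
  apply: lime_ge; first exact: cvgA.
  by apply: nearW => n; rewrite lee_fin; have [_ + _] := Sn_adm n; exact.
have AeW x : Ae x <= (W x)%:E.
  apply: lime_le; first exact: cvgA.
  by apply: nearW => n; rewrite lee_fin; have [_ _ +] := Sn_adm n; exact.
have AeE x : (fine (Ae x))%:E = Ae x.
  by rewrite fineK// ge0_fin_numE// (le_lt_trans (AeW x))// ltry.
have mA : measurable_fun setT Ae.
  apply: (emeasurable_fun_cvg (fun n x => (Sn n x)%:E)) => //.
  by move=> n; apply: mEu; have [] := Sn_adm n.
exists (fun x => fine (Ae x)); split.
- exact: (measurableT_comp (fine_measurable measurableT)).
- by move=> x; exact: fine_ge0.
- by move=> x; rewrite -lee_fin AeE.
move=> x.
under eq_integral do rewrite AeE.
under [in RHS]eq_integral do rewrite AeE.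
rewrite AeE.
have cvgQ : (fun n => (q (Sn n) x)%:E) @ \oo --> \int[P x]_w Ae (Y w).
  rewrite (_ : (fun n => _) = fun n => \int[P x]_w (Sn n (Y w))%:E); last first.
    by apply/funext => n; rewrite q_fin.
  have H := @cvg_monotone_convergence _ _ _ (P x) setT measurableT
    (fun n w => (Sn n (Y w))%:E).
  apply: H.
  - by move=> n; apply: mEY; have [] := Sn_adm n.
  - by move=> n w _; rewrite lee_fin; have [_ + _] := Sn_adm n; exact.
  - by move=> w _; exact: Sn_nd.
have cvgN : (fun n => (nu (Sn n))%:E) @ \oo --> c%:E * \int[mu]_(y in C) Ae y.
  rewrite (_ : (fun n => _) =
      fun n => c%:E * \int[mu]_(y in C) (Sn n y)%:E); last first.
    by apply/funext => n; rewrite nu_fin.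
  apply: cvgeZl => //.
  have H := @cvg_monotone_convergence _ _ _ mu C mC (fun n y => (Sn n y)%:E).
  apply: H.
  - by move=> n; apply: mEu; have [] := Sn_adm n.
  - by move=> n w _; rewrite lee_fin; have [_ + _] := Sn_adm n; exact.
  - by move=> w _; exact: Sn_nd.
have H1 : (fun n => (Sn n.+1 x)%:E + (\1_C x)%:E * (nu (Sn n))%:E) @ \oo -->
    Ae x + (\1_C x)%:E * (c%:E * \int[mu]_(y in C) Ae y).
  apply: cvgeD.
  - by rewrite -AeE fin_num_adde_defr.
  - by have := cvgA x; rewrite -(cvg_shiftS (fun n => (Sn n x)%:E)); exact.
  - exact: cvgeZl.
have H2 : (fun n => (Sn n.+1 x)%:E + (\1_C x)%:E * (nu (Sn n))%:E) @ \oo -->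
    (h x)%:E + \int[P x]_w Ae (Y w).
  rewrite (_ : (fun n => _) = (fun n => (h x)%:E + (q (Sn n) x)%:E)).
    by apply: cvgeD => //; exact: cvg_cst.
  by apply/funext => n; rewrite -EFinM -!EFinD; congr EFin; rewrite /= /Q'; ring.
exact: (cvg_unique _ H1 H2).
Qed.

End potential.
End regeneration.

(** * Poisson equation for the p-step chain *)

Section poisson_equation.
Context (R : realType) (d dO : measure_display)
  (T : measurableType d) (Omega : measurableType dO).
Variables (mu : {sigma_finite_measure set T -> \bar R}) (f : T -> T -> R).
Hypothesis hf : transition_density mu f.
Variables (X : nat -> Omega -> T) (Px : T -> probability Omega R).
Hypothesis hPx : started_chain mu f X Px.
Variables (p : nat) (C : set T) (fp : T -> T -> \bar R).
Hypotheses (mC : measurable C) (muC : mu C < +oo)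
  (hfp : step_density mu X Px p fp).
Hypothesis fstar : 0 < ereal_inf [set fp x y | x in C & y in C].
Variable lambda : probability T R.
Hypothesis inv : forall B, measurable B ->
  lambda B = \int[lambda]_x \int[mu]_(y in B) (f x y)%:E.
Variables (V : T -> R) (rho D : R).
Hypotheses (mV : measurable_fun [set: T] V) (V1 : forall x, (1 <= V x)%R).
Hypotheses (rho0 : (0 < rho)%R) (rho1 : (rho < 1)%R) (D0 : (0 < D)%R).
Hypothesis drift : forall x,
  \int[Px x]_w (V (X p w))%:E <= ((1 - rho) * V x + D * \1_C x)%:E.

Let V0 x : (0 <= V x)%R. Proof. exact: le_trans (V1 x). Qed.

Let lC0 : 0 < lambda C.
Proof.
exact: (stationary_small_set_gt0 hf hPx mC inv mV V1 rho0 rho1 D0 drift).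
Qed.

Let lV : \int[lambda]_x (V x)%:E < +oo.
Proof. exact: (stationary_Lyapunov hf hPx inv mV V1 rho0 rho1 D0 drift). Qed.

(** X_p has density fp, so a mu-null C would also be lambda-null. *)
Lemma small_set_measure_gt0 : 0 < mu C.
Proof.
rewrite lt0e measure_ge0 andbT; apply/eqP => muC0.
have mC1 : measurable_fun setT (fun x => (\1_C x : R)%:E).
  by apply/measurable_EFinP; exact: measurable_indic.
have : lambda C = 0.
  transitivity (\int[lambda]_x (\1_C x : R)%:E).
    by rewrite integral_indic// setIT.
  rewrite -(evol_invariant hf hPx p inv mC1)//.
  apply: integral0_eq => x _; have [mfp fp0 fpE] := hfp x.
  transitivity (Px x (X p @^-1` C)).
    have mX : measurable_fun setT (X p) by exact: measurable_chain hPx p.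
    have mXC : measurable (X p @^-1` C).
      by rewrite -[Y in measurable Y]setTI; exact: mX.
    rewrite -[RHS](_ : Px x (X p @^-1` C `&` setT) = _); last by rewrite setIT.
    by rewrite -integral_indic.
  by rewrite fpE// null_set_integral//; exact: measurable_funTS.
by move=> H; move: lC0; rewrite H ltxx.
Qed.

(** Integrating the identity of the potential against the invariant law cancels
    A and leaves nu(A) = lambda(h) / lambda(C). *)
Lemma stationary_potential (h : T -> R) : measurable_fun setT h ->
  (forall x, 0 <= h x)%R -> (forall x, h x <= V x)%R ->
  exists (A : T -> R) (b : R),
  [/\ measurable_fun setT A, (forall x, 0 <= A x)%R, (0 <= b)%R,
      (forall x, A x <= b * V x)%R &
      forall x, (A x + \1_C x * (fine (\int[lambda]_x (h x)%:E) / fine (lambda C)) =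
        h x + fine (evol X Px p (EFin \o A) x))%R].
Proof.
move=> mh h0 hV.
have [c c0 minor] := minorization hPx mC hfp fstar.
have mP (k : T -> \bar R) : measurable_fun setT k -> (forall x, 0 <= k x) ->
    measurable_fun setT (fun x => \int[Px x]_w k (X p w)).
  exact: (measurable_evol hf hPx).
have [A [mA A0 AW AE]] := regeneration_potential (measurable_chain hPx p) mP
  mC muC small_set_measure_gt0 c0 minor mV V1 rho0 D0 drift mh h0 hV.
set delta := (c * fine (mu C))%R in AW.
have delta0 : (0 < delta)%R.
  by rewrite mulr_gt0// fine_gt0// small_set_measure_gt0.
pose b := ((1 + D / delta) / rho)%R.
have b0 : (0 <= b)%R.
  by rewrite divr_ge0 ?(ltW rho0)// addr_ge0// divr_ge0// ltW.
have AbV x : (A x <= b * V x)%R.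
  apply: (le_trans (AW x)).
  rewrite /regen_bound /b mulrAC ler_wpM2r ?invr_ge0 ?(ltW rho0)//.
  by rewrite mulrDl mul1r lerD2l ler_peMr// divr_ge0// ltW.
exists A, b; split => //.
have mAE : measurable_fun setT (fun x => (A x)%:E) by exact/measurable_EFinP.
have mhE : measurable_fun setT (fun x => (h x)%:E) by exact/measurable_EFinP.
have mVE : measurable_fun setT (fun x => (V x)%:E) by exact/measurable_EFinP.
have mC1 : measurable_fun setT (fun x => (\1_C x : R)%:E).
  by apply/measurable_EFinP; exact: measurable_indic.
have AE0 x : 0 <= (A x)%:E by rewrite lee_fin.
have hE0 x : 0 <= (h x)%:E by rewrite lee_fin.
have VE0 x : 0 <= (V x)%:E by rewrite lee_fin.
have lfin (k : T -> R) (a : R) : (forall x, 0 <= k x)%R ->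
    (forall x, k x <= a * V x)%R -> (0 <= a)%R ->
    \int[lambda]_x (k x)%:E \is a fin_num.
  move=> k0 kV a0; rewrite ge0_fin_numE; last first.
    by apply: integral_ge0 => x _; rewrite lee_fin.
  apply: (@le_lt_trans _ _ (\int[lambda]_x (a%:E * (V x)%:E))).
    by apply: ge0_le_integral_nonmeas => x; rewrite -?EFinM lee_fin.
  by rewrite ge0_integralZl// lte_mul_pinfty// lee_fin.
have lA : \int[lambda]_x (A x)%:E \is a fin_num by exact: (lfin A b).
have lh : \int[lambda]_x (h x)%:E \is a fin_num.
  by apply: (lfin h 1%R) => // x; rewrite mul1r.
set a := c%:E * _ in AE.
have a0 : 0 <= a.
  rewrite /a mule_ge0 ?lee_fin ?(ltW c0)//.
  by apply: integral_ge0 => x _.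
clearbody a.
have lC : lambda C \is a fin_num by exact: fin_num_measure.
have aE : lambda C * a = \int[lambda]_x (h x)%:E.
  have : \int[lambda]_x ((A x)%:E + (\1_C x)%:E * a) =
         \int[lambda]_x ((h x)%:E + evol X Px p (fun x => (A x)%:E) x).
    by apply: eq_integral => x _; exact: AE.
  have i1 x : @setT T x -> 0 <= (A x)%:E by [].
  have i2 x : @setT T x -> 0 <= (\1_C x : R)%:E * a.
    by move=> _; rewrite mule_ge0// lee_fin.
  have i3 x : @setT T x -> 0 <= (h x)%:E by [].
  have i4 x : @setT T x -> 0 <= evol X Px p (fun x => (A x)%:E) x.
    by move=> _; exact: evol_ge0.
  have i5 x : @setT T x -> 0 <= (\1_C x : R)%:E by rewrite lee_fin.
  have m2 : measurable_fun setT (fun x => (\1_C x : R)%:E * a).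
    by apply: emeasurable_funM => //; exact: measurable_cst.
  have m4 : measurable_fun setT (evol X Px p (fun x => (A x)%:E)).
    exact: (measurable_evol hf hPx).
  rewrite ge0_integralD// ge0_integralD//.
  rewrite (evol_invariant hf hPx p inv)// ge0_integralZr//.
  rewrite integral_indic// setIT [LHS]addeC.
  by move=> /(congr1 (fun z => z - \int[lambda]_x (A x)%:E)); rewrite !addeK.
have afin : a \is a fin_num.
  rewrite ge0_fin_numE// ltey; apply/eqP => aoo.
  by move: lh; rewrite -aE aoo gt0_muley.
have aR : fine a = (fine (\int[lambda]_x (h x)%:E) / fine (lambda C))%R.
  rewrite -aE fineM// mulrAC divff ?mul1r//.
  by rewrite gt_eqF// fine_gt0// lC0 ltey_eq lC.
move=> x; rewrite -aR; apply: EFin_inj; rewrite !EFinD EFinM fineK//.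
rewrite fineK; first exact: AE.
rewrite ge0_fin_numE; last exact: evol_ge0.
rewrite ltey; apply/eqP => evoo; have := AE x.
by rewrite -[a]fineK// -EFinM -EFinD -/(evol X Px p (fun x => (A x)%:E) x) evoo.
Qed.

End poisson_equation.

(** * Corrector for the one-step chain *)

Section corrector.
Context (R : realType) (d dO : measure_display)
  (T : measurableType d) (Omega : measurableType dO).
Variables (mu : {sigma_finite_measure set T -> \bar R}) (f0 f1 : T -> T -> R).
Hypotheses (hf0 : transition_density mu f0) (hf1 : transition_density mu f1).
Hypothesis hsupp : forall x y, (0 < f0 x y)%R <-> (0 < f1 x y)%R.
Variables (X : nat -> Omega -> T) (Px : T -> probability Omega R).
Hypothesis hPx : started_chain mu f1 X Px.

Local Notation E := (evol X Px).

Section fine_evolution.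
Variable B : T -> R.
Hypotheses (mB : measurable_fun setT B) (B0 : forall x, (0 <= B x)%R).

Let mBE : measurable_fun setT (EFin \o B). Proof. exact/measurable_EFinP. Qed.
Let BE0 x : 0 <= (EFin \o B) x. Proof. by rewrite lee_fin. Qed.

Lemma measurable_fine_evol n :
  measurable_fun setT (fun x => fine (E n (EFin \o B) x)).
Proof.
apply: (measurableT_comp (fine_measurable measurableT)).
exact: (measurable_evol hf1 hPx).
Qed.

(** The evolution of B may be infinite on a set that the chain from x almost
    surely avoids at time 1; reading it as 0 there does not change the integral. *)
Lemma fine_evol_step n x : E n.+1 (EFin \o B) x < +oo ->
  (Px x).-integrable setT (fun w => (fine (E n (EFin \o B) (X 1%N w)))%:E) /\
  \int[Px x]_w (fine (E n (EFin \o B) (X 1%N w)))%:E =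
    (fine (E n.+1 (EFin \o B) x))%:E.
Proof.
move=> fin; set e := E n (EFin \o B).
have e0 y : 0 <= e y by exact: evol_ge0.
have me : measurable_fun setT e by exact: (measurable_evol hf1 hPx).
have mX : measurable_fun setT (X 1%N) by exact: measurable_chain hPx 1%N.
have meX : measurable_fun setT (e \o X 1%N) by exact: measurableT_comp.
have mfX : measurable_fun setT (fun w => (fine (e (X 1%N w)))%:E).
  apply/measurable_EFinP.
  exact: (measurableT_comp (measurable_fine_evol n) mX).
have Ie : \int[Px x]_w e (X 1%N w) = E n.+1 (EFin \o B) x.
  by rewrite -[LHS]/(E 1%N e x) (evol_evol1 hf1 hPx).
have ie : (Px x).-integrable setT (e \o X 1%N).
  apply/integrableP; split => //.
  under eq_integral do rewrite /= gee0_abs//.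
  by rewrite Ie.
have ife : (Px x).-integrable setT (fun w => (fine (e (X 1%N w)))%:E).
  apply: le_integrable ie => // w _ /=.
  by move: (e0 (X 1%N w)); case: (e _) => [a||]//= _; rewrite ?normr0 ?leey.
split => //.
rewrite fineK; last by rewrite ge0_fin_numE// evol_ge0.
rewrite -Ie; apply: ge0_ae_eq_integral => //.
- by move=> w _; rewrite lee_fin fine_ge0.
- by have := integrable_ae measurableT ie; apply: filterS => w /(_ Logic.I) h _;
  rewrite fineK.
Qed.

End fine_evolution.

Lemma llr_chain x h : mean_llr mu f0 f1 x = h%:E ->
  (Px x).-integrable setT (fun w => (llr f0 f1 (X 1%N w) x)%:E) /\
  \int[Px x]_w (llr f0 f1 (X 1%N w) x)%:E = h%:E.
Proof.
move=> hx; pose g y := (llr f0 f1 y x)%:E.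
have [mf1 f10 f1_1] := hf1.
have mg : measurable_fun setT g.
  apply/measurable_EFinP.
  apply: (measurableT_comp (measurable_llr hf0 hf1 hsupp)
    (g := fun y => (x, y))).
  exact/measurable_fun_pair.
have mX : measurable_fun setT (X 1%N) by exact: measurable_chain hPx 1%N.
have tr (k : T -> \bar R) : measurable_fun setT k -> (forall y, 0 <= k y) ->
    \int[Px x]_w k (X 1%N w) = \int[mu]_y (k y * (f1 x y)%:E).
  exact: (evol1 hf1 hPx).
have fin : mean_llr mu f0 f1 x < +oo by rewrite hx ltry.
have /integrableP[mgf gf] := llr_integrable hf0 hf1 hsupp fin.
split.
  apply/integrableP; split; first exact: measurableT_comp mg mX.
  rewrite (tr (fun y => `|g y|))//; last exact: measurableT_comp.
  apply: le_lt_trans gf; apply: ge0_le_integral_nonmeas => y.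
    by rewrite mule_ge0// lee_fin.
  by rewrite EFinM abseM (@gee0_abs _ (f1 x y)%:E) ?lee_fin.
rewrite -hx /mean_llr integralE [RHS]integralE; congr (_ - _).
- transitivity (\int[Px x]_w (g^\+ (X 1%N w))).
    by apply: eq_integral => w _; rewrite !funeposE.
  rewrite tr; [|exact: measurable_funepos|exact: funepos_ge0].
  apply: eq_integral => y _.
  by rewrite !funeposE -EFin_max -EFinM maxr_pMl// mul0r EFin_max.
- transitivity (\int[Px x]_w (g^\- (X 1%N w))).
    by apply: eq_integral => w _; rewrite !funenegE.
  rewrite tr; [|exact: measurable_funeneg|exact: funeneg_ge0].
  apply: eq_integral => y _.
  by rewrite !funenegE -!EFinN -EFin_max -EFinM maxr_pMl// mul0r mulNr EFin_max.
Qed.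

Variables (p : nat) (A B : T -> R) (I : R).
Hypotheses (mA : measurable_fun setT A) (A0 : forall x, (0 <= A x)%R).
Hypotheses (mB : measurable_fun setT B) (B0 : forall x, (0 <= B x)%R).

Definition corrector_term n x : R :=
  (fine (E n (EFin \o A) x) - I * fine (E n (EFin \o B) x))%R.

(** A solution of the Poisson equation for the p-step chain, summed along p
    consecutive steps, solves it for the one-step chain. *)
Definition corrector x : R := (\sum_(i < p) corrector_term i x)%R.

Definition increment (z : T * T) : R :=
  (llr f0 f1 z.2 z.1 - I + corrector z.2 - corrector z.1)%R.

Lemma measurable_corrector_term n : measurable_fun setT (corrector_term n).
Proof.
apply: measurable_funB; first exact: measurable_fine_evol.
by apply: measurable_funM => //; exact: measurable_fine_evol.
Qed.

Lemma measurable_corrector : measurable_fun setT corrector.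
Proof. by apply: measurable_sum => i; exact: measurable_corrector_term. Qed.

Lemma measurable_increment : measurable_fun setT increment.
Proof.
have mc := measurable_corrector.
apply: measurable_funB; last exact: measurableT_comp.
apply: measurable_funD; last exact: measurableT_comp.
by apply: measurable_funB => //; exact: (measurable_llr hf0 hf1 hsupp).
Qed.

Variables (V : T -> R) (b : R).
Hypotheses (mV : measurable_fun setT V) (V1 : forall x, (1 <= V x)%R)
  (b0 : (0 <= b)%R).
Hypotheses (AbV : forall x, (A x <= b * V x)%R)
  (BbV : forall x, (B x <= b * V x)%R).

Let V0 x : (0 <= V x)%R. Proof. exact: le_trans (V1 x). Qed.

Let mVE : measurable_fun setT (EFin \o V). Proof. exact/measurable_EFinP. Qed.
Let VE0 x : 0 <= (EFin \o V) x. Proof. by rewrite lee_fin. Qed.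

Lemma evol_fin_le (h : T -> R) n x : (forall x, 0 <= h x)%R ->
  (forall x, h x <= b * V x)%R -> E n (EFin \o V) x < +oo ->
  E n (EFin \o h) x < +oo.
Proof.
move=> h0 hV fin.
have mX : measurable_fun setT (X n) by exact: measurable_chain hPx n.
apply: (@le_lt_trans _ _ (b%:E * E n (EFin \o V) x)); last first.
  by rewrite lte_mul_pinfty// lee_fin.
rewrite /evol -ge0_integralZl//.
- by apply: ge0_le_integral_nonmeas => w /=; rewrite -?EFinM lee_fin.
- exact: measurableT_comp.
Qed.

Lemma corrector_term_step n x : E n.+1 (EFin \o V) x < +oo ->
  (Px x).-integrable setT (fun w => (corrector_term n (X 1%N w))%:E) /\
  \int[Px x]_w (corrector_term n (X 1%N w))%:E = (corrector_term n.+1 x)%:E.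
Proof.
move=> fin.
have [iA EA] := fine_evol_step mA A0 (evol_fin_le A0 AbV fin).
have [iB EB] := fine_evol_step mB B0 (evol_fin_le B0 BbV fin).
have iIB := integrableZl measurableT I iB.
have iS := integrableB measurableT iA iIB.
split; first exact: iS.
rewrite -[LHS]/(\int[Px x]_w ((fun w => (fine (E n (EFin \o A) (X 1%N w)))%:E) \-
  (fun w => I%:E * (fine (E n (EFin \o B) (X 1%N w)))%:E)) w).
by rewrite integralB// integralZl// EA EB.
Qed.

Lemma corrector_step n x :
  (forall i, (i <= n)%N -> E i (EFin \o V) x < +oo) ->
  (Px x).-integrable setT (fun w => (\sum_(i < n) corrector_term i (X 1%N w))%:E) /\
  \int[Px x]_w (\sum_(i < n) corrector_term i (X 1%N w))%:E =
    (\sum_(i < n) corrector_term i.+1 x)%:E.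
Proof.
elim: n => [|n IH] fin.
  split; first by under eq_fun do rewrite big_ord0; exact: integrable0.
  by under eq_integral do rewrite big_ord0; rewrite integral0 big_ord0.
have [i1 E1] := IH (fun i ni => fin i (leqW ni)).
have [i2 E2] := corrector_term_step (fin n.+1 (leqnn _)).
split.
  under eq_fun do rewrite big_ord_recr.
  exact: (integrableD measurableT i1 i2).
under eq_integral do rewrite big_ord_recr.
by rewrite big_ord_recr /= integralD_EFin// E1 E2.
Qed.

Variable h : T -> R.
Hypothesis hE : forall x, mean_llr mu f0 f1 x = (h x)%:E.
Hypothesis poisson : forall x, (h x - I = (A x - I * B x) -
  (fine (E p (EFin \o A) x) - I * fine (E p (EFin \o B) x)))%R.

(** One step shifts the summands of the corrector, so its mean telescopes to the
    terms of index p and 0, whose difference is the one in the Poisson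
    equation. *)
Lemma increment_mean x : (forall i, (i <= p)%N -> E i (EFin \o V) x < +oo) ->
  (Px x).-integrable setT (fun w => (increment (x, X 1%N w))%:E) /\
  \int[Px x]_w (increment (x, X 1%N w))%:E = 0.
Proof.
move=> fin.
have [i1 E1] := llr_chain (hE x).
have [i2 E2] := corrector_step fin.
pose k : R := (- I - corrector x)%R.
have i3 : (Px x).-integrable setT (fun w => k%:E).
  exact: finite_measure_integrable_cst.
have incE w : increment (x, X 1%N w) =
    (llr f0 f1 (X 1%N w) x + \sum_(i < p) corrector_term i (X 1%N w) + k)%R.
  by rewrite /increment /k /corrector /=; ring.
have i12 := integrableD measurableT i1 i2.
split.
  under eq_fun do rewrite incE.
  exact: (integrableD measurableT i12 i3).
under eq_integral do rewrite incE.
rewrite integralD_EFin// integralD_EFin// E1 E2.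
rewrite integral_probability_cst -!EFinD; congr EFin.
have tele : (\sum_(i < p) corrector_term i.+1 x - corrector x =
    corrector_term p x - corrector_term 0 x)%R.
  rewrite /corrector -sumrB; elim: (p) => [|n IH].
    by rewrite big_ord0 subrr.
  by rewrite big_ord_recr/= IH; ring.
have c0 : corrector_term 0 x = (A x - I * B x)%R.
  rewrite /corrector_term !(evol0 hPx)//=.
  - exact/measurable_EFinP.
  - exact/measurable_EFinP.
have := poisson x; rewrite -c0 -/(corrector_term p x) => H.
have -> : (h x + \sum_(i < p) corrector_term i.+1 x + k =
  (h x - I) + (\sum_(i < p) corrector_term i.+1 x - corrector x))%R by rewrite /k; ring.
by rewrite H tele; ring.
Qed.

Variable r : R.
Hypothesis r1 : (1 < r)%R.

Let mpow (k : T -> R) : measurable_fun setT k ->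
  measurable_fun setT (fun x => (k x `^ r)%:E).
Proof.
by move=> mk; apply/measurable_EFinP; exact: (measurableT_comp (measurable_powR r)).
Qed.

Lemma fine_evol_pow (k : T -> R) n x : measurable_fun setT k ->
  (forall x, 0 <= k x)%R -> (forall x, k x <= b * V x)%R ->
  (fine (E n (EFin \o k) x) `^ r)%:E <=
  (b `^ r)%:E * E n (fun y => (V y `^ r)%:E) x.
Proof.
move=> mk k0 kV; have r0 : (0 <= r)%R by rewrite ltW// (lt_trans _ r1).
have mX : measurable_fun setT (X n) by exact: measurable_chain hPx n.
apply: (le_trans (@jensen_powR R _ _ (Px x) r (k \o X n) r1 _ _)) => //.
- exact: measurableT_comp.
- by move=> w /=.
rewrite /evol -ge0_integralZl//; last 3 first.
- exact: (measurableT_comp (mpow mV) mX).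
- by move=> w _; rewrite lee_fin powR_ge0.
- by rewrite lee_fin powR_ge0.
apply: ge0_le_integral_nonmeas => w; first by rewrite lee_fin powR_ge0.
by rewrite -EFinM lee_fin -powRM// ler_powRl/=.
Qed.

Definition corrector_cst : R :=
  ((2 `^ r) ^+ p * (2 `^ r * (1 + `|I| `^ r) * b `^ r))%R.

Lemma corrector_cst_ge0 : (0 <= corrector_cst)%R.
Proof. by rewrite !mulr_ge0 ?exprn_ge0 ?addr_ge0 ?powR_ge0. Qed.

Lemma corrector_pow x : (`|corrector x| `^ r)%:E <=
  corrector_cst%:E * \sum_(i < p) E i (fun y => (V y `^ r)%:E) x.
Proof.
have r0 : (0 < r)%R by rewrite (lt_trans _ r1).
have S0 i : 0 <= E i (fun y => (V y `^ r)%:E) x.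
  by apply: evol_ge0 => y; rewrite lee_fin powR_ge0.
apply: (@le_trans _ _ ((2 `^ r) ^+ p * \sum_(i < p) `|corrector_term i x| `^ r)%:E).
  by rewrite lee_fin; exact: (powR_sum_le p (fun i => corrector_term i x) r0).
rewrite /corrector_cst !EFinM -muleA lee_wpmul2l ?lee_fin ?exprn_ge0 ?powR_ge0//.
rewrite -sumEFin ge0_sume_distrr//; apply: lee_sum => i _.
apply: (@le_trans _ _ (2 `^ r * (fine (E i (EFin \o A) x) `^ r +
    `|I| `^ r * fine (E i (EFin \o B) x) `^ r))%:E).
  rewrite lee_fin /corrector_term; apply: (le_trans (powR_normD _ _ (ltW r0))).
  rewrite normrN normrM powRM//.
  have fE0 k : (forall y, 0 <= k y)%R -> (0 <= fine (E i (EFin \o k) x))%R.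
    by move=> k0; rewrite fine_ge0// evol_ge0.
  by rewrite (ger0_norm (fE0 _ A0)) (ger0_norm (fE0 _ B0)).
rewrite EFinM -!muleA lee_wpmul2l ?lee_fin ?powR_ge0//.
rewrite EFinD EFinM [(1 + _)%:E]EFinD ge0_muleDl ?lee_fin ?powR_ge0// mul1e.
apply: leeD; first exact: fine_evol_pow.
by rewrite lee_wpmul2l ?lee_fin ?powR_ge0//; exact: fine_evol_pow.
Qed.

End corrector.

(** * Sums of increments with conditional mean zero *)

Section additive_martingale.
Context (R : realType) (d dO : measure_display)
  (T : measurableType d) (Omega : measurableType dO).
Variables (mu : {sigma_finite_measure set T -> \bar R}) (f1 : T -> T -> R).
Hypothesis hf1 : transition_density mu f1.
Variables (X : nat -> Omega -> T) (Px : T -> probability Omega R).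
Hypothesis hPx : started_chain mu f1 X Px.
Variables (P : probability Omega R) (f : nat -> T -> T -> R).
Hypotheses (hf : forall n, transition_density mu (f n))
  (hM : markov_process mu P X f).
Variable k : nat.
Hypothesis ff1 : forall j, (k <= j)%N -> f j.+1 = f1.
Variable inc : T * T -> R.
Hypothesis minc : measurable_fun setT inc.

Let Y j : Omega -> T := X (k + j)%N.
Let dM j w : R := inc (Y j w, Y j.+1 w).

Definition additive_sum n (w : Omega) : R :=
  (\sum_(j < n) inc (X (k + j)%N w, X (k + j).+1 w))%R.

Local Notation M := additive_sum.

Hypothesis inc_mean : forall j, {ae P, forall w,
  (Px (Y j w)).-integrable setT (fun w' => (inc (Y j w, X 1%N w'))%:E) /\
  \int[Px (Y j w)]_w' (inc (Y j w, X 1%N w'))%:E = 0}.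

(** The past of the sum is measured in the sigma-algebra generated by the
    history, seen as a measurable structure on Omega. *)
Lemma history_additive_sum j E : measurable E ->
  history X (k + j) ((fun w => (M j w, X (k + j)%N w)) @^-1` E).
Proof.
move=> mE.
pose G := [set A | exists i B,
  [/\ (i <= k + j)%N, measurable B & A = X i @^-1` B]].
pose Om := g_sigma_algebraType G.
have mX i : (i <= k + j)%N -> measurable_fun [set: Om] (X i : Om -> T).
  move=> ij _ B mB; rewrite setTI; apply: sub_sigma_algebra.
  by exists i, B.
have mZ : measurable_fun [set: Om]
    ((fun w => (M j w, X (k + j)%N w)) : Om -> R * T).
  apply/measurable_fun_pair => /=; last exact: mX.
  apply: measurable_sum => i; have ij := ltn_ord i.
  apply: (measurableT_comp minc (g := fun w : Om => (X (k + i)%N w, X (k + i).+1 w))).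
  apply/measurable_fun_pair; apply: mX; first by rewrite leq_add2l ltnW.
  by rewrite -addnS leq_add2l.
rewrite -[Y in history _ _ Y]setTI; exact: mZ.
Qed.

Let mY j : measurable_fun setT (Y j). Proof. exact: hM.1. Qed.

Let mdM j : measurable_fun setT (dM j).
Proof.
apply: (measurableT_comp minc (g := fun w => (Y j w, Y j.+1 w))).
exact/measurable_fun_pair.
Qed.

Let ME n w : M n w = (\sum_(j < n) dM j w)%R.
Proof. by apply: eq_bigr => j _; rewrite /dM /Y addnS. Qed.

Variables (r : R) (K : R).
Hypotheses (r2 : (2 < r)%R) (K0 : (0 <= K)%R).
Hypothesis inc_pow : forall j,
  \int[P]_w (`|inc (X (k + j)%N w, X (k + j).+1 w)| `^ r)%:E <= K%:E.

Let weight (z : (R * T) * T) : R :=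
  (`|z.1.1| `^ (r - 2) * z.1.1 * inc (z.1.2, z.2))%R.

Let mweight : measurable_fun setT weight.
Proof.
apply: measurable_funM.
  apply: measurable_funM; last exact: measurableT_comp.
  apply: (measurableT_comp (measurable_powR (r - 2))).
  by apply: measurableT_comp => //; exact: measurableT_comp.
apply: (measurableT_comp minc (g := fun z : (R * T) * T => (z.1.2, z.2))).
by apply/measurable_fun_pair => //; exact: measurableT_comp.
Qed.

Let Z j w := (M j w, X (k + j)%N w).

Let weight_kernel (phi : (R * T) * T -> \bar R) j :
  measurable_fun setT phi -> (forall z, 0 <= phi z) ->
  \int[P]_w phi (Z j w, X (k + j).+1 w) =
  \int[P]_w \int[Px (X (k + j)%N w)]_w' phi (Z j w, X 1%N w').
Proof.
move=> mphi phi0; rewrite (markov_joint hf hM)//; last first.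
  exact: history_additive_sum.
rewrite ff1 ?leq_addr//; apply: eq_integral => w _.
have mp : measurable_fun setT (fun y => phi (Z j w, y)).
  by apply: (measurableT_comp mphi); exact/measurable_fun_pair.
by rewrite -[RHS]/(evol X Px 1 (fun y => phi (Z j w, y)) (X (k + j)%N w))
  (evol1 hf1 hPx).
Qed.

(** Given M_j and Y_j, the positive and the negative part of the weighted
    increment have the same mean. *)
Let orth j :
  P.-integrable setT (fun w => (`|M j w| `^ (r - 2) * M j w * dM j w)%:E) ->
  \int[P]_w (`|M j w| `^ (r - 2) * M j w * dM j w)%:E = 0.
Proof.
move=> ij; pose F w := (weight (Z j w, X (k + j).+1 w))%:E.
have FE : (fun w => (`|M j w| `^ (r - 2) * M j w * dM j w)%:E) = F.
  by apply/funext => w; rewrite /F /weight /dM /Y /= addnS.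
move: ij; rewrite FE => iF.
pose wp z := maxe (weight z)%:E 0; pose wn z := maxe (- (weight z)%:E) 0.
have mw : measurable_fun setT (EFin \o weight) by exact/measurable_EFinP.
have mwp : measurable_fun setT wp.
  by apply: measurable_maxe => //; exact: measurable_cst.
have mwn : measurable_fun setT wn.
  by apply: measurable_maxe; [exact: measurableT_comp|exact: measurable_cst].
have wp0 z : 0 <= wp z by rewrite /wp le_max lexx orbT.
have wn0 z : 0 <= wn z by rewrite /wn le_max lexx orbT.
have FpE : \int[P]_w F^\+ w = \int[P]_w wp (Z j w, X (k + j).+1 w).
  by apply: eq_integral => w _; rewrite funeposE.
have FnE : \int[P]_w F^\- w = \int[P]_w wn (Z j w, X (k + j).+1 w).
  by apply: eq_integral => w _; rewrite funenegE.
have pn : \int[P]_w F^\+ w = \int[P]_w F^\- w.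
  rewrite FpE FnE (weight_kernel j mwp wp0) (weight_kernel j mwn wn0).
  have mk (phi : (R * T) * T -> \bar R) : measurable_fun setT phi ->
      (forall z, 0 <= phi z) -> measurable_fun setT
      (fun w => \int[Px (X (k + j)%N w)]_w' phi (Z j w, X 1%N w')).
    move=> mphi phi0.
    have mZ : measurable_fun setT (Z j).
      move=> _ A mA; rewrite setTI; apply: (measurable_history hM (n := k + j)).
      exact: history_additive_sum.
    rewrite (_ : (fun w => _) = (fun z => \int[mu]_y (phi (z, y) * (f1 z.2 y)%:E))
       \o Z j).
      apply: measurableT_comp => //.
      exact: (measurable_kernel_integral (X := snd) hf1).
    apply/funext => w.
    have mp : measurable_fun setT (fun y => phi (Z j w, y)).
      by apply: (measurableT_comp mphi); exact/measurable_fun_pair.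
    by rewrite -[LHS]/(evol X Px 1 (fun y => phi (Z j w, y)) (X (k + j)%N w))
      (evol1 hf1 hPx).
  apply: ge0_ae_eq_integral => //; [exact: mk|exact: mk| | |].
  - by move=> w _; apply: integral_ge0.
  - by move=> w _; apply: integral_ge0.
  have := inc_mean j; apply: filterS => w [inc_int inc0] _.
  pose m := (`|M j w| `^ (r - 2) * M j w)%R.
  have im := integrableZl measurableT m inc_int.
  have := integralZl measurableT inc_int m.
  rewrite inc0 mule0 integralE => /eqP.
  rewrite sube_eq; last 2 first.
  - exact: integrable_pos_fin_num.
  - exact: fin_num_adde_defr.
  rewrite add0e => /eqP H.
  transitivity (\int[Px (Y j w)]_w'
    (fun w' => m%:E * (inc (Y j w, X 1%N w'))%:E)^\+ w').
    by apply: eq_integral => w' _; rewrite funeposE /wp /weight -EFinM.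
  rewrite H.
  by apply: eq_integral => w' _; rewrite funenegE /wn /weight -EFinM.
rewrite integralE pn subee//.
exact: integrable_neg_fin_num.
Qed.

Lemma additive_martingale_moment n : (0 < n)%N ->
  \int[P]_w (`|M n w| `^ r)%:E <= (martingale_cst r * n%:R `^ (r / 2) * K)%:E.
Proof.
move=> n0; rewrite (eq_integral (fun w => (`|\sum_(j < n) dM j w| `^ r)%:E)).
  apply: martingale_moment => // j.
    by have := inc_pow j; rewrite /dM /Y addnS.
  move=> ij; rewrite -[RHS](orth (j := j)).
    by apply: eq_integral => w _; rewrite ME.
  by under eq_fun do rewrite ME.
by move=> w _; rewrite ME.
Qed.

End additive_martingale.

(** * Tail of the log-likelihood ratio *)

Section tail.
Context (R : realType) (d dO : measure_display)
  (T : measurableType d) (Omega : measurableType dO).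
Variables (mu : {sigma_finite_measure set T -> \bar R}) (f0 f1 : T -> T -> R).
Hypotheses (hf0 : transition_density mu f0) (hf1 : transition_density mu f1).
Hypothesis hsupp : forall x y, (0 < f0 x y)%R <-> (0 < f1 x y)%R.
Variables (X : nat -> Omega -> T) (P : option nat -> probability Omega R).
Hypothesis hP : change_point_model mu f0 f1 X P.
Variable Px : T -> probability Omega R.
Hypothesis hPx : started_chain mu f1 X Px.
Variables (p : nat) (A B V h : T -> R) (I b r : R).
Hypotheses (mA : measurable_fun setT A) (A0 : forall x, (0 <= A x)%R).
Hypotheses (mB : measurable_fun setT B) (B0 : forall x, (0 <= B x)%R).
Hypotheses (mV : measurable_fun setT V) (V1 : forall x, (1 <= V x)%R).
Hypotheses (b0 : (0 <= b)%R) (AbV : forall x, (A x <= b * V x)%R)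
  (BbV : forall x, (B x <= b * V x)%R).
Hypothesis hE : forall x, mean_llr mu f0 f1 x = (h x)%:E.
Hypothesis poisson : forall x, (h x - I = (A x - I * B x) -
  (fine (evol X Px p (EFin \o A) x) - I * fine (evol X Px p (EFin \o B) x)))%R.
Hypothesis r2 : (2 < r)%R.
Variables (k : nat) (Mg Mv : R).
Hypotheses (Mg0 : (0 <= Mg)%R) (Mv0 : (0 <= Mv)%R).
Hypothesis hMg : \int[P None]_w gstar f0 f1 X Px r (X k w) <= Mg%:E.
Hypothesis hMv : \int[P None]_w vstar V X Px r (X k w) <= Mv%:E.

Local Notation Q := (P (Some k)).
Local Notation u := (corrector X Px p A B I).
Local Notation inc := (increment f0 f1 X Px p A B I).
Local Notation g z := (llr f0 f1 z.2 z.1).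

Let r0 : (0 <= r)%R. Proof. by rewrite ltW// (lt_trans _ r2). Qed.
Let r1 : (1 < r)%R. Proof. by rewrite (lt_trans _ r2)// ltr1n. Qed.

Let hM : markov_process mu Q X (change_density f0 f1 (Some k)).
Proof. exact: hP.1. Qed.

Let hf : forall n, transition_density mu (change_density f0 f1 (Some k) n).
Proof. exact: change_density_transition. Qed.

Let ff1 j : (k <= j)%N -> change_density f0 f1 (Some k) j.+1 = f1.
Proof. by move=> kj; rewrite /change_density ltnNge kj. Qed.

Let mX n : measurable_fun setT (X n). Proof. exact: hM.1. Qed.

Let Vr x := (V x `^ r)%:E.

Let mVr : measurable_fun setT Vr.
Proof.
by apply/measurable_EFinP; exact: (measurableT_comp (measurable_powR r)).
Qed.

Let Vr0 x : 0 <= Vr x. Proof. by rewrite lee_fin powR_ge0. Qed.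

Let mVE : measurable_fun setT (EFin \o V). Proof. exact/measurable_EFinP. Qed.

Let VE0 x : 0 <= (EFin \o V) x.
Proof. by rewrite lee_fin (le_trans _ (V1 x)). Qed.

Lemma Lyapunov_moment j : \int[Q]_w Vr (X (k + j)%N w) <= Mv%:E.
Proof.
rewrite (post_change_law hf0 hf1 hP hPx k j mVr Vr0); apply: le_trans hMv.
apply: ge0_le_integral_nonmeas => w; first exact: evol_ge0.
by apply: ereal_sup_ubound; exists j.
Qed.

Lemma evol_moment i j phi : measurable_fun setT phi -> (forall x, 0 <= phi x) ->
  \int[Q]_w evol X Px i phi (X (k + j)%N w) = \int[Q]_w phi (X (k + (j + i))%N w).
Proof.
move=> mphi phi0; rewrite addnA.
have fk l : (k + j <= l)%N -> change_density f0 f1 (Some k) l.+1 = f1.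
  by move=> kl; apply: ff1; rewrite (leq_trans _ kl)// leq_addr.
rewrite (markov_iter hf hM i fk mphi phi0).
by apply: eq_integral => w _; rewrite (evolE hf1 hPx).
Qed.

Let cu : R := corrector_cst p I b r.
Let cu0 : (0 <= cu)%R. Proof. exact: corrector_cst_ge0. Qed.
Let Mu : R := (cu * (p%:R * Mv))%R.

Let mpow (v : Omega -> R) : measurable_fun setT v ->
  measurable_fun setT (fun w => (`|v w| `^ r)%:E).
Proof.
move=> mv; apply/measurable_EFinP; apply: (measurableT_comp (measurable_powR r)).
exact: measurableT_comp.
Qed.

Let mcorr n : measurable_fun setT (fun w => u (X n w)).
Proof.
exact: (measurableT_comp (measurable_corrector hf1 hPx p I mA A0 mB B0)).
Qed.

Lemma corrector_moment j :
  \int[Q]_w (`|u (X (k + j)%N w)| `^ r)%:E <= Mu%:E.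
Proof.
have mE i : measurable_fun setT (fun w => evol X Px i Vr (X (k + j)%N w)).
  exact: (measurableT_comp (measurable_evol hf1 hPx i mVr Vr0)).
apply: (@le_trans _ _ (\int[Q]_w
    (cu%:E * \sum_(i < p) evol X Px i Vr (X (k + j)%N w)))).
  apply: ge0_le_integral_nonmeas => w; first by rewrite lee_fin powR_ge0.
  exact: (corrector_pow hPx p I mA A0 mB B0 mV V1 b0 AbV BbV r1).
rewrite ge0_integralZl//; last 2 first.
- exact: emeasurable_sum.
- by move=> w _; apply: sume_ge0 => i _; exact: evol_ge0.
rewrite /Mu [leRHS]EFinM lee_wpmul2l ?lee_fin//.
rewrite ge0_integral_sum//; last by move=> i w _; exact: evol_ge0.
apply: (@le_trans _ _ (\sum_(i < p) Mv%:E)).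
  by apply: lee_sum => i _; rewrite evol_moment// Lyapunov_moment.
by rewrite sumEFin sumr_const card_ord lee_fin mulr_natl.
Qed.

Let mg2 : measurable_fun setT (fun z : T * T => (`|g z| `^ r)%:E).
Proof.
apply/measurable_EFinP; apply: (measurableT_comp (measurable_powR r)).
apply: measurableT_comp => //; exact: (measurable_llr hf0 hf1 hsupp).
Qed.

Lemma llr_moment j :
  \int[Q]_w (`|llr f0 f1 (X (k + j).+1 w) (X (k + j)%N w)| `^ r)%:E <= Mg%:E.
Proof.
have g0 z : 0 <= (`|g z| `^ r)%:E by rewrite lee_fin powR_ge0.
have /= -> := post_change_pair hf0 hf1 hP hPx k j mg2 g0.
apply: le_trans hMg; apply: ge0_le_integral_nonmeas => w.
  by apply: integral_ge0 => w' _; exact: (g0 (X j w', X j.+1 w')).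
by apply: ereal_sup_ubound; exists j.+1.
Qed.

Let Kinc : R := (2 `^ r * (2 `^ r * (2 `^ r * (Mg + `|I| `^ r) + Mu) + Mu))%R.

Let Mu0 : (0 <= Mu)%R. Proof. by apply: mulr_ge0 => //; exact: mulr_ge0. Qed.

Let Kinc0 : (0 <= Kinc)%R.
Proof.
by do 3! (apply: mulr_ge0; first exact: powR_ge0; apply: addr_ge0 => //).
Qed.

Let ge0_int_powR_normD (v1 v2 : Omega -> R) (K1 K2 : R) :
  measurable_fun setT v1 -> measurable_fun setT v2 ->
  \int[Q]_w (`|v1 w| `^ r)%:E <= K1%:E -> \int[Q]_w (`|v2 w| `^ r)%:E <= K2%:E ->
  \int[Q]_w (`|v1 w + v2 w| `^ r)%:E <= (2 `^ r * (K1 + K2))%:E.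
Proof.
move=> m1 m2 i1 i2.
have p0 (v : Omega -> R) w : @setT Omega w -> 0 <= (`|v w| `^ r)%:E.
  by rewrite lee_fin powR_ge0.
apply: (@le_trans _ _ (\int[Q]_w
    ((2 `^ r)%:E * ((`|v1 w| `^ r)%:E + (`|v2 w| `^ r)%:E)))).
  apply: ge0_le_integral_nonmeas => w; first by rewrite lee_fin powR_ge0.
  by rewrite -EFinD -EFinM lee_fin powR_normD.
have ms : measurable_fun setT (fun w => (`|v1 w| `^ r)%:E + (`|v2 w| `^ r)%:E).
  by apply: emeasurable_funD; exact: mpow.
have s0 w : @setT Omega w -> 0 <= (`|v1 w| `^ r)%:E + (`|v2 w| `^ r)%:E.
  by move=> _; rewrite adde_ge0 ?p0.
have c0 : 0 <= (2 `^ r)%:E :> \bar R by rewrite lee_fin powR_ge0.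
rewrite (ge0_integralZl Q measurableT ms s0 c0).
rewrite (ge0_integralD Q measurableT (p0 v1) (mpow m1) (p0 v2) (mpow m2)).
by rewrite EFinM EFinD lee_wpmul2l ?lee_fin ?powR_ge0// leeD.
Qed.

Let mllr j : measurable_fun setT
  (fun w => llr f0 f1 (X (k + j).+1 w) (X (k + j)%N w)).
Proof.
apply: (measurableT_comp (measurable_llr hf0 hf1 hsupp)
  (g := fun w => (X (k + j)%N w, X (k + j).+1 w))).
exact/measurable_fun_pair.
Qed.

Lemma increment_moment j :
  \int[Q]_w (`|inc (X (k + j)%N w, X (k + j).+1 w)| `^ r)%:E <= Kinc%:E.
Proof.
have mcst (a : R) : measurable_fun [set: Omega] (fun=> a) by [].
have mN (v : Omega -> R) : measurable_fun setT v -> measurable_fun setT (fun w => - v w)%R.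
  by move=> mv; exact: measurableT_comp.
rewrite /increment /=.
have I1 := llr_moment j.
have I2 : \int[Q]_w (`|(- I)%R| `^ r)%:E <= (`|I| `^ r)%:E.
  by rewrite integral_probability_cst normrN.
have I3 : \int[Q]_w (`|u (X (k + j).+1 w)| `^ r)%:E <= Mu%:E.
  by have := corrector_moment j.+1; rewrite addnS.
have I4 : \int[Q]_w (`|(- u (X (k + j)%N w))%R| `^ r)%:E <= Mu%:E.
  by under eq_integral do rewrite normrN; exact: corrector_moment.
have m1 := mllr j.
have m12 := measurable_funD m1 (mcst (- I)%R).
have m123 := measurable_funD m12 (mcorr (k + j).+1).
have I12 := ge0_int_powR_normD m1 (mcst (- I)%R) I1 I2.
have I123 := ge0_int_powR_normD m12 (mcorr (k + j).+1) I12 I3.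
exact: (ge0_int_powR_normD m123 (mN _ (mcorr (k + j)%N)) I123 I4).
Qed.

Lemma increment_mean_ae j : {ae Q, forall w,
  (Px (X (k + j)%N w)).-integrable setT
    (fun w' => (inc (X (k + j)%N w, X 1%N w'))%:E) /\
  \int[Px (X (k + j)%N w)]_w' (inc (X (k + j)%N w, X 1%N w'))%:E = 0}.
Proof.
pose S w := \sum_(i < p.+1) evol X Px i (EFin \o V) (X (k + j)%N w).
have mE i : measurable_fun setT (fun w => evol X Px i (EFin \o V) (X (k + j)%N w)).
  exact: (measurableT_comp (measurable_evol hf1 hPx i mVE VE0)).
have E0 i w : 0 <= evol X Px i (EFin \o V) (X (k + j)%N w) by exact: evol_ge0.
have S0 w : 0 <= S w by exact: sume_ge0.
have iS : Q.-integrable setT S.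
  apply/integrableP; split; first exact: emeasurable_sum.
  under eq_integral do rewrite gee0_abs//.
  rewrite /S ge0_integral_sum//.
  apply: (@le_lt_trans _ _ (\sum_(i < p.+1) Mv%:E)); last by rewrite sumEFin ltry.
  apply: lee_sum => i _; rewrite evol_moment//.
  apply: le_trans (Lyapunov_moment (j + i)).
  apply: ge0_le_integral_nonmeas => w; first exact: VE0.
  by rewrite lee_fin le1r_powR// ltW.
have := integrable_ae measurableT iS; apply: filterS => w /(_ Logic.I) Sfin.
apply: (increment_mean hf0 hf1 hsupp hPx mA A0 mB B0 mV V1 b0 AbV BbV hE poisson).
move=> i ip.
apply: (@le_lt_trans _ _ (S w)); last by rewrite ltey_eq Sfin.
rewrite /S (bigD1 (Ordinal (ip : (i < p.+1)%N)))//= leeDl//.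
exact: sume_ge0.
Qed.

Let LLRE n w : LLR f0 f1 X k (k + n)%N w =
  (\sum_(j < n) llr f0 f1 (X (k + j).+1 w) (X (k + j)%N w))%R.
Proof.
rewrite /LLR -[k.+1]add0n big_addn subSS addKn big_mkord.
by apply: eq_bigr => j _; rewrite addnS/= (addnC j).
Qed.

Let mn n := (martingale_cst r * n%:R `^ (r / 2) * Kinc)%R.

(** The log-likelihood ratio is the sum of the increments up to the telescoping
    differences of the corrector. *)
Lemma LLR_moment n : (0 < n)%N ->
  \int[Q]_w (`|LLR f0 f1 X k (k + n)%N w - n%:R * I| `^ r)%:E <=
  (2 `^ r * (mn n + 2 `^ r * (Mu + Mu)))%:E.
Proof.
move=> n0.
have minc := measurable_increment hf0 hf1 hsupp hPx p I mA A0 mB B0.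
have iM : \int[Q]_w (`|additive_sum X k inc n w| `^ r)%:E <= (mn n)%:E.
  apply: (additive_martingale_moment hf1 hPx hf hM ff1 minc increment_mean_ae r2)
    => //.
  exact: increment_moment.
have mM : measurable_fun setT (additive_sum X k inc n).
  apply: measurable_sum => i.
  apply: (measurableT_comp minc (g := fun w => (X (k + i)%N w, X (k + i).+1 w))).
  exact/measurable_fun_pair.
have mN : measurable_fun setT (fun w => - u (X (k + n)%N w))%R.
  exact: measurableT_comp.
have I1 : \int[Q]_w (`|(- u (X (k + n)%N w))%R| `^ r)%:E <= Mu%:E.
  by under eq_integral do rewrite normrN; exact: corrector_moment.
have I2 : \int[Q]_w (`|u (X k w)| `^ r)%:E <= Mu%:E.
  by have := corrector_moment 0; rewrite addn0.
have I12 := ge0_int_powR_normD mN (mcorr k) I1 I2.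
have := ge0_int_powR_normD mM (measurable_funD mN (mcorr k)) iM I12.
apply: le_trans; rewrite le_eqVlt; apply/orP; left; apply/eqP.
apply: eq_integral => w _; congr (`|_| `^ r)%:E.
rewrite LLRE /additive_sum /=.
elim: n {n0 iM mM mN I1 I12} => [|n IH].
  by rewrite !big_ord0 addn0 mul0r subrr add0r addNr.
rewrite !big_ord_recr/=; move: IH; rewrite !addnS/=.
set s1 := (\sum_(i < n) _)%R; set s2 := (\sum_(i < n) _)%R.
by rewrite -natr1 /increment/= => IH; lra.
Qed.

Definition tail_cst : R := (2 `^ r * (martingale_cst r * Kinc + 2 `^ r * (Mu + Mu)))%R.

(** Markov's inequality for the r-th moment; tail_cst depends on k through Mg and
    Mv alone. *)
Lemma deviation_tail n eps : (0 < n)%N -> (0 < eps)%R ->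
  Q (deviation f0 f1 X I%:E eps k n) <=
  (tail_cst / eps `^ r * n%:R `^ (- (r / 2)))%:E.
Proof.
move=> n0 e0.
have n0' : (0 < n%:R :> R)%R by rewrite ltr0n.
pose L w := (LLR f0 f1 X k (k + n)%N w - n%:R * I)%R.
have mL : measurable_fun setT L.
  apply: measurable_funB => //.
  rewrite [Y in measurable_fun _ Y](funext (LLRE n)).
  by apply: measurable_sum => j; exact: mllr.
have devE : deviation f0 f1 X I%:E eps k n = [set w | (n%:R * eps < `|L w|)%R].
  rewrite /deviation; apply/seteqP.
  have E w : (n%:R^-1 * LLR f0 f1 X k (k + n)%N w - I = n%:R^-1 * L w)%R.
    by rewrite /L mulrBr mulKf ?gt_eqF.
  by split => w /=; rewrite lte_fin E normrM normfV normr_nat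
    ltr_pdivlMl.
have mdev : measurable [set w | (n%:R * eps < `|L w|)%R].
  rewrite (_ : [set w | _] =
      (fun w => `|L w|%R) @^-1` `](n%:R * eps)%R, +oo[%classic); last first.
    by apply/seteqP; split => w /=; rewrite in_itv/= andbT.
  rewrite -[Y in measurable Y]setTI.
  have mL' : measurable_fun setT (fun w => `|L w|%R) by exact: measurableT_comp.
  exact: mL'.
rewrite devE -[X in Q X]setIT -integral_indic//.
pose c := ((n%:R * eps) `^ (- r) : R)%R.
have c0 : (0 <= c)%R by exact: powR_ge0.
apply: (@le_trans _ _ (\int[Q]_w (c%:E * (`|L w| `^ r)%:E))).
  apply: ge0_le_integral_nonmeas => w; first by rewrite lee_fin.
  rewrite -EFinM lee_fin indicE; case: (boolP (w \in _)) => [|_]; last first.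
    by rewrite mulr_ge0// powR_ge0.
  rewrite inE /= => H; rewrite /c powRN mulrC ler_pdivlMr ?powR_gt0 ?mulr_gt0//.
  by rewrite mul1r ler_powRl// ltW// mulr_gt0.
have pL w : @setT Omega w -> 0 <= (`|L w| `^ r)%:E by rewrite lee_fin powR_ge0.
have c0' : 0 <= c%:E by rewrite lee_fin.
rewrite (ge0_integralZl Q measurableT (mpow mL) pL c0').
apply: (@le_trans _ _ (c%:E * (2 `^ r * (mn n + 2 `^ r * (Mu + Mu)))%:E)).
  by rewrite lee_wpmul2l ?lee_fin//; exact: LLR_moment.
rewrite -EFinM lee_fin /c powRM ?(ltW n0') ?(ltW e0)//.
have nr : (n%:R `^ (- r) * n%:R `^ (r / 2) = n%:R `^ (- (r / 2)) :> R)%R.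
  rewrite -powRD; first by congr (_ `^ _)%R; field.
  by rewrite pnatr_eq0 -lt0n n0 implybT.
have n1 : (1 <= n%:R `^ (r / 2) :> R)%R.
  by rewrite -[leLHS](powRr0 n%:R) ler_powR ?ler1n// divr_ge0.
rewrite [leRHS](_ : _ = n%:R `^ (- r) * eps `^ (- r) *
    (tail_cst * n%:R `^ (r / 2)))%R; last by rewrite -nr (powRN eps); ring.
rewrite ler_wpM2l ?mulr_ge0 ?powR_ge0//.
rewrite /tail_cst -mulrA ler_wpM2l ?powR_ge0// mulrDl /mn lerD//.
  by rewrite le_eqVlt; apply/orP; left; apply/eqP; ring.
by rewrite ler_peMr// mulr_ge0 ?powR_ge0// addr_ge0.
Qed.

End tail.

(** * Summability *)

(** Solving the Poisson equation for the drift of the log-likelihood ratio: the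
    potentials of h and of the constant 1 regenerate at the same rate up to the
    factor I, so that the regeneration terms cancel in A - I B. *)
Lemma poisson_solution (R : realType) (d dO : measure_display)
    (T : measurableType d) (Omega : measurableType dO)
    (mu : {sigma_finite_measure set T -> \bar R}) (f : T -> T -> R)
    (X : nat -> Omega -> T) (Px : T -> probability Omega R)
    (p : nat) (C : set T) (fp : T -> T -> \bar R) (lambda : probability T R)
    (V h : T -> R) (rho D : R) :
  transition_density mu f -> started_chain mu f X Px ->
  measurable C -> mu C < +oo -> step_density mu X Px p fp ->
  0 < ereal_inf [set fp x y | x in C & y in C] ->
  (forall B, measurable B ->
    lambda B = \int[lambda]_x \int[mu]_(y in B) (f x y)%:E) ->
  measurable_fun [set: T] V -> (forall x, (1 <= V x)%R) ->
  (0 < rho)%R -> (rho < 1)%R -> (0 < D)%R ->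
  (forall x,
    \int[Px x]_w (V (X p w))%:E <= ((1 - rho) * V x + D * \1_C x)%:E) ->
  measurable_fun [set: T] h -> (forall x, (0 <= h x)%R) ->
  (forall x, (h x <= V x)%R) ->
  let I := fine (\int[lambda]_x (h x)%:E) in
  exists (A B : T -> R) (b : R),
  [/\ measurable_fun [set: T] A /\ measurable_fun [set: T] B,
      (forall x, 0 <= A x)%R /\ (forall x, 0 <= B x)%R, (0 <= b)%R,
      (forall x, A x <= b * V x)%R /\ (forall x, B x <= b * V x)%R &
      forall x, (h x - I = (A x - I * B x) - (fine (evol X Px p (EFin \o A) x)
        - I * fine (evol X Px p (EFin \o B) x)))%R].
Proof.
move=> hf hPx mC muC hfp fstar inv mV V1 rho0 rho1 D0 drift mh h0 hV I.
have pot := stationary_potential hf hPx mC muC hfp fstar inv mV V1 rho0 rho1 D0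
  drift.
have [A [a [mA A0 a0 AV EA]]] := pot h mh h0 hV.
have [B [b [mB B0 b0 BV EB]]] := pot (cst 1%R) (measurable_cst _)
  (fun=> ler01) V1.
have V0 x : (0 <= V x)%R by exact: le_trans (V1 x).
exists A, B, (a + b)%R; split => //.
- exact: addr_ge0.
- split=> x; [apply: (le_trans (AV x))|apply: (le_trans (BV x))];
    rewrite ler_wpM2r//; [rewrite lerDl//|rewrite lerDr//].
move=> x; have := EA x; have := EB x; rewrite -/I.
rewrite [X in fine X](integral_probability_cst lambda 1%E) /= div1r.
set e := fine (evol _ _ _ _ _); set q := fine (evol _ _ _ _ _).
set t := (fine (lambda C))^-1%R; set i := (\1_C x)%R => HB HA.
have -> : h x = (A x + i * (I * t) - q)%R by lra.
have {2}-> : I = (I * (B x + i * t - e))%R.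
  by rewrite HB; ring.
ring.
Qed.

Theorem theorem10 (R : realType) (d dO : measure_display)
  (T : measurableType d) (Omega : measurableType dO)
  (mu : {sigma_finite_measure set T -> \bar R})
  (f0 f1 : T -> T -> R)
  (hf0 : transition_density mu f0) (hf1 : transition_density mu f1)
  (* f0 and f1 have the same support, so that g = log (f1 / f0) is finite *)
  (hsupp : forall x y, (0 < f0 x y)%R <-> (0 < f1 x y)%R)
  (X : nat -> Omega -> T)
  (P : option nat -> probability Omega R)
  (hP : change_point_model mu f0 f1 X P)
  (Px : T -> probability Omega R)
  (hPx : started_chain mu f1 X Px)
  (lambda : probability T R)
  (herg : positive_ergodic mu f1 X Px lambda)
  (hg : forall x, integral_exists mu (fun y => (llr f0 f1 y x * f1 x y)%:E))
  (hI : integral_exists lambda (mean_llr mu f0 f1))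
  (p : nat) (hp : (1 <= p)%N)
  (C : set T) (mC : measurable C) (muC : mu C < +oo)
  (fp : T -> T -> \bar R) (hfp : step_density mu X Px p fp)
  (hfstar : 0 < ereal_inf [set fp x y | x in C & y in C])
  (V : T -> R) (mV : measurable_fun [set: T] V)
  (V1 : forall x, (1 <= V x)%R)
  (Vg : forall x, mean_llr mu f0 f1 x <= (V x)%:E)
  (Vstar : ereal_sup [set (V x)%:E | x in C] < +oo)
  (rho D : R) (rho0 : (0 < rho)%R) (rho1 : (rho < 1)%R) (D0 : (0 < D)%R)
  (drift : forall x,
    \int[Px x]_w (V (X p w))%:E <= ((1 - rho) * V x + D * \1_C x)%:E)
  (r : R) (r2 : (2 < r)%R)
  (hgstar : ereal_sup [set \int[P None]_w gstar f0 f1 X Px r (X k w) |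
     k in [set k | (1 <= k)%N]] < +oo)
  (hvstar : ereal_sup [set \int[P None]_w vstar V X Px r (X k w) |
     k in [set k | (1 <= k)%N]] < +oo) :
  let I := \int[lambda]_x mean_llr mu f0 f1 x in
  (forall eps : R, (0 < eps)%R ->
    \sum_(1 <= n <oo) ereal_sup [set P (Some k) (deviation f0 f1 X I eps k n) |
      k in [set k | (1 <= k)%N]] < +oo)
  /\
  (* the moment assumption for k >= 1 does not constrain the law of X_0, so
     the change point k = 0 is included under the same assumption at k = 0 *)
  (\int[P None]_w gstar f0 f1 X Px r (X 0%N w) < +oo ->
   \int[P None]_w vstar V X Px r (X 0%N w) < +oo ->
   forall eps : R, (0 < eps)%R ->
    \sum_(1 <= n <oo) ereal_sup [set P (Some k) (deviation f0 f1 X I eps k n) |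
      k in [set: nat]] < +oo).
Proof.
have V0 x : (0 <= V x)%R by exact: le_trans (V1 x).
have gfin x : mean_llr mu f0 f1 x < +oo by exact: le_lt_trans (Vg x) (ltry _).
have g0 x := mean_llr_ge0 hf0 hf1 hsupp (gfin x).
pose h x := fine (mean_llr mu f0 f1 x).
have hE x : mean_llr mu f0 f1 x = (h x)%:E.
  by rewrite /h fineK// ge0_fin_numE.
have mh : measurable_fun setT h.
  by apply: (measurableT_comp (fine_measurable measurableT)); exact: hI.1.
have h0 x : (0 <= h x)%R by exact: fine_ge0.
have hV x : (h x <= V x)%R by rewrite -lee_fin -hE.
move=> I; have inv := herg.1.
have lV := stationary_Lyapunov hf1 hPx inv mV V1 rho0 rho1 D0 drift.
have IE : I = (fine (\int[lambda]_x (h x)%:E))%:E.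
  have -> : I = \int[lambda]_x (h x)%:E.
    by apply: eq_integral => x _; rewrite hE.
  rewrite fineK// ge0_fin_numE; last first.
    by apply: integral_ge0 => x _; rewrite lee_fin.
  apply: le_lt_trans lV; apply: ge0_le_integral_nonmeas => x; rewrite lee_fin//.
have [A [B [b [[mA mB] [A0 B0] b0 [AV BV] poisson]]]] :=
  poisson_solution hf1 hPx mC muC hfp hfstar inv mV V1 rho0 rho1 D0 drift mh h0 hV.
have summable (S : set nat) (Mg Mv : R) : S !=set0 -> (0 <= Mg)%R -> (0 <= Mv)%R ->
    (forall k, S k -> \int[P None]_w gstar f0 f1 X Px r (X k w) <= Mg%:E) ->
    (forall k, S k -> \int[P None]_w vstar V X Px r (X k w) <= Mv%:E) ->
    forall eps : R, (0 < eps)%R ->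
    \sum_(1 <= n <oo) ereal_sup [set P (Some k) (deviation f0 f1 X I eps k n) |
      k in S] < +oo.
  (* the supremum over an empty set of change points would be -oo *)
  move=> [k0 Sk0] Mg0 Mv0 hMg hMv eps eps0; rewrite IE.
  have tl k n (Sk : S k) (n0 : (0 < n)%N) := deviation_tail hf0 hf1 hsupp hP hPx
    mA A0 mB B0 mV V1 b0 AV BV hE poisson r2 Mg0 Mv0 (hMg k Sk) (hMv k Sk) n0 eps0.
  set c := (tail_cst _ _ _ _ _ _ / _)%R in tl.
  have c0 : (0 <= c)%R.
    have := tl k0 1%N Sk0 isT; rewrite powR1 mulr1 => /(le_trans (measure_ge0 _ _)).
    by rewrite lee_fin.
  have s1 : (1 < r / 2)%R by rewrite ltr_pdivlMr// mul1r.
  apply: le_lt_trans (nneseries_powR_lty c0 s1); apply: lee_lim.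
  - apply: is_cvg_nneseries => n _ _.
    apply: le_trans (ereal_sup_ubound _); last by exists k0.
    exact: measure_ge0.
  - by apply: is_cvg_nneseries => n _ _; rewrite lee_fin mulr_ge0 ?powR_ge0.
  apply: nearW => N; rewrite big_seq [leRHS]big_seq; apply: lee_sum => n.
  rewrite mem_index_iota => /andP[n0 _].
  by apply: ge_ereal_sup => _ [k Sk <-]; exact: tl.
have bnd (F : nat -> \bar R) : (forall k, 0 <= F k) ->
    ereal_sup [set F k | k in [set k | (1 <= k)%N]] < +oo ->
    exists2 M : R, (0 <= M)%R & forall k, (1 <= k)%N -> F k <= M%:E.
  move=> F0 Ffin; pose s := ereal_sup [set F k | k in [set k | (1 <= k)%N]].
  have Fs k : (1 <= k)%N -> F k <= s.
    by move=> k1; apply: ereal_sup_ubound; exists k.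
  have s0 : 0 <= s by apply: le_trans (Fs 1%N isT).
  exists (fine s); first exact: fine_ge0.
  by move=> k k1; rewrite fineK ?ge0_fin_numE// Fs.
have bnd0 (F : nat -> \bar R) (M : R) : (forall k, 0 <= F k) -> F 0%N < +oo ->
    (0 <= M)%R -> (forall k, (1 <= k)%N -> F k <= M%:E) ->
    exists2 M' : R, (0 <= M')%R & forall k, F k <= M'%:E.
  move=> F0 Ffin M0 FM; exists (M + fine (F 0%N))%R.
    by rewrite addr_ge0// fine_ge0.
  move=> [|k]; rewrite EFinD fineK ?ge0_fin_numE//; first by rewrite leeDr.
  by rewrite (le_trans (FM _ (ltn0Sn k)))// leeDl.
have gs0 k : 0 <= \int[P None]_w gstar f0 f1 X Px r (X k w).
  apply: integral_ge0 => w _; apply: le_trans (ereal_sup_ubound _); last first.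
    by exists 1%N => //.
  by apply: integral_ge0 => w' _; rewrite lee_fin powR_ge0.
have vs0 k : 0 <= \int[P None]_w vstar V X Px r (X k w).
  apply: integral_ge0 => w _; apply: le_trans (ereal_sup_ubound _); last first.
    by exists 0%N => //.
  by apply: integral_ge0 => w' _; rewrite lee_fin powR_ge0.
have [Mg Mg0 hMg] := bnd _ gs0 hgstar.
have [Mv Mv0 hMv] := bnd _ vs0 hvstar.
split; first by apply: (summable _ Mg Mv) => //; exists 1%N.
move=> g0fin v0fin.
have [Mg' Mg'0 hMg'] := bnd0 _ Mg gs0 g0fin Mg0 hMg.
have [Mv' Mv'0 hMv'] := bnd0 _ Mv vs0 v0fin Mv0 hMv.
apply: (summable [set: nat] Mg' Mv') => [||//|k _|k _].
- by exists 0%N.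
- exact: Mg'0.
- exact: hMg'.
- exact: hMv'.
Qed.
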